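(* Let $1\le k\le n$ and let $\gamma_n^k$ be the total space of the canonical vector bundle over the Grassmannian $G_n^k$ of $k$-dimensional linear subspaces of $\mathbb R^n$. Let $V_1,\dots,V_{n+1}\subseteq\gamma_n^k$ be compact sets such that for every $i$ and every $L\in G_n^k$ the intersection $V_i\cap L$ with the fiber over $L$ is non-empty and depends continuously on $L$ in the Hausdorff metric. Suppose that for every $L\in G_n^k$ the family $\{V_i\cap L\}_{i=1}^{n+1}$ is non-antipodal in $L$, and the set $\left(\bigcup_{i=1}^{n+1}V_i\right)\cap L$ is convex. Then $V_1,\dots,V_{n+1}$ have a common point.
   Context: The fiber of $\gamma_n^k$ over $L$ is identified with the vector space $L$. For a convex compact set $K$, two points of $\partial K$ are called antipodal with respect to $K$ if they lie in a pair of supporting hyperplanes of $K$ with opposite outer normals. A family $\mathcal F$ of compact sets is called non-antipodal if no set $V\in\mathcal F$ contains a pair of points antipodal with respect to $\operatorname{conv}\bigcup\mathcal F$. *)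

(* Defs.v *)
From HB Require Import structures.
From mathcomp Require Import all_boot all_order all_algebra.
From mathcomp Require Import all_classical all_reals all_analysis.

Set Implicit Arguments.
Unset Strict Implicit.
Unset Printing Implicit Defensive.

Import Order.TTheory GRing.Theory Num.Theory.
Import numFieldNormedType.Exports.

Local Open Scope classical_set_scope.
Local Open Scope ring_scope.

Section Grassmannian.
Variables (R : realType) (n k : nat).

Record grassmannian := Grassmannian {
  subspace_of :> {vspace 'rV[R]_n};
  _ : \dim subspace_of == k
}.

HB.instance Definition _ := [isSub for subspace_of].
HB.instance Definition _ := [Choice of grassmannian by <:].

Definition frame_seq (A : 'M[R]_(k, n)) : seq 'rV[R]_n :=
  [seq row i A | i <- enum 'I_k].

(* The non-compact Stiefel manifold, with the topology induced by 'M_(k, n). *)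
Definition frames : set 'M[R]_(k, n) := [set A | free (frame_seq A)].

Lemma dim_frame_span (A : frames) : \dim <<frame_seq (val A)>>%VS == k.
Proof.
have /set_mem := valP A; rewrite /frames /= /free => /eqP ->.
by rewrite size_map size_enum_ord.
Qed.

Definition frame_span (A : frames) : grassmannian :=
  Grassmannian (dim_frame_span A).

(* The quotient topology with respect to the surjection [frame_span]. *)
Definition grassmannian_open (U : set grassmannian) : Prop :=
  open (frame_span @^-1` U).

Lemma grassmannian_openT : grassmannian_open setT.
Proof. by rewrite /grassmannian_open preimage_setT; exact: openT. Qed.

Lemma grassmannian_openI : setI_closed grassmannian_open.
Proof. by move=> U W oU oW; exact: openI. Qed.

Lemma grassmannian_open_bigU (I : Type) (f : I -> set grassmannian) :
  (forall i, grassmannian_open (f i)) -> grassmannian_open (\bigcup_i f i).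
Proof.
move=> of_; rewrite /grassmannian_open preimage_bigcup.
by apply: bigcup_open => i _; exact: of_.
Qed.

HB.instance Definition _ := isOpenTopological.Build grassmannian
  grassmannian_openT grassmannian_openI grassmannian_open_bigU.

(* The total space of the canonical bundle, as a subspace of the product. *)
Definition canonical_bundle : set (grassmannian * 'rV[R]_n) :=
  [set p : grassmannian * 'rV[R]_n | p.2 \in subspace_of p.1].

Definition fiber (V : set (grassmannian * 'rV[R]_n)) (L : grassmannian) :
  set 'rV[R]_n := [set x | V (L, x)].

End Grassmannian.

Section Euclidean.
Variables (R : realType) (n : nat).
Implicit Types (K : set 'rV[R]_n) (L : {vspace 'rV[R]_n}) (x y u : 'rV[R]_n).

Definition dotv x y : R := \sum_(i < n) x 0 i * y 0 i.

Definition eucl_dist x y : R := Num.sqrt (dotv (x - y) (x - y)).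

Definition dist_to_set x K : R := inf [set eucl_dist x y | y in K].

Definition hausdorff_dist (K1 K2 : set 'rV[R]_n) : R :=
  Num.max (sup [set dist_to_set x K2 | x in K1])
          (sup [set dist_to_set y K1 | y in K2]).

Definition convex_hull K : set 'rV[R]_n :=
  \bigcap_(C in [set C : set 'rV[R]_n |
      @convex_set R 'rV[R]_n C /\ K `<=` C]) C.

(* Boundary relative to the ambient space L, which is closed in R^n. *)
Definition boundary_in L K : set 'rV[R]_n :=
  closure K `&` closure ([set` L] `\` K).

(* H is a supporting hyperplane of K in the ambient space L, with outer
   normal u. *)
Definition supporting_hyperplane L K u (H : set 'rV[R]_n) : Prop :=
  [/\ u \in L, u != 0 & exists c : R,
    [/\ H = [set x | x \in L /\ dotv u x = c],
        forall x, K x -> dotv u x <= c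
      & K `&` H !=set0]].

Definition antipodal L K x y : Prop :=
  [/\ x != y, boundary_in L K x, boundary_in L K y &
    exists (u : 'rV[R]_n) (H1 H2 : set 'rV[R]_n),
      [/\ supporting_hyperplane L K u H1,
          supporting_hyperplane L K (- u) H2, H1 x & H2 y]].

Definition non_antipodal L (I : Type) (F : I -> set 'rV[R]_n) : Prop :=
  forall i x y, F i x -> F i y ->
    ~ antipodal L (convex_hull (\bigcup_j F j)) x y.

End Euclidean.

(* Main.v *)
(* Restrict the bundle to the k-planes L = W + R v, where W is a fixed
   (k - 1)-plane and v a unit vector of its orthogonal complement. Sending
   x in L to the point of the fibre of the union nearest to rho x, with rho
   large, turns V_1, .., V_{n+1} into a closed cover of the disc bundle over
   this projective space of planes, an n-manifold M with boundary; non-antipodality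
   says that no set of the cover contains a boundary point x of M together with
   - x. (If the fibre lies in a hyperplane of L, non-antipodality makes each
   V_i meet L in one point, and convexity makes these points equal.)

   Label a fine triangulation of M by the cover. By Sperner's counting, the
   number of simplices carrying all n + 1 labels has the parity of the degree of the
   labelling from the boundary of M to the boundary of the simplex. As points x
   and - x carry different labels, Fan's alternating-simplex count along the
   skeleta of the boundary shows that this degree is odd. So there are fully
   labelled simplices of arbitrarily small size, and they accumulate at a common
   point.

   M is parametrized by a cube [-1, 1]^n through polynomial spherical
   coordinates; faces of the cube are either collapsed, or identified in pairs,
   so that they cancel modulo 2. *)

Require Import Defs.
From HB Require Import structures.
From mathcomp Require Import all_boot all_order all_algebra.
From mathcomp Require Import all_classical all_reals all_analysis.
From mathcomp Require Import zify ring lra.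

Set Implicit Arguments.
Unset Strict Implicit.
Unset Printing Implicit Defensive.

Import Order.TTheory GRing.Theory Num.Theory.
Import numFieldNormedType.Exports.

Local Open Scope classical_set_scope.
Local Open Scope ring_scope.

(** * Parity of labellings of cubical grids *)

Section Parity.
Local Open Scope nat_scope.

(** The planes W + R v already carry the whole obstruction. Projectivize their bundle over the
    projective space of lines R v, and let t and a be the mod 2 classes of the two tautological
    lines: t^k = a t^(k-1), so t^(n-1) = a^(n-k) t^(k-1) is nonzero. The induction over skeleta is a
    combinatorial substitute for this fact.

    A boundary vertex x with label p at x and q at - x acts as the vector e_p - e_q. If a boundary
    simplex has the labels 0, .., n - 1, the antipodes of its vertices must all have label n; up to
    a twist of signs this is an alternating pattern, and the opposite pattern describes the
    antipodal simplex. So Sperner's doors on the boundary are alternating simplices of both signs.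

    The triangulation is the barycentric subdivision of a cubical grid: vertices are cells, labelled
    at their barycentres, simplices are flags of cells, and each count is a cochain with values in
    F_2 evaluated on a chain.

    Non-antipodality speaks about exact supporting hyperplanes, which nearest points reach only as
    rho tends to infinity. Compactness therefore fixes rho first, and then a mesh that depends on
    rho. *)

Lemma addrr_F2 (x : 'F_2) : (x + x = 0)%R.
Proof. by apply: addrr_pchar2; rewrite pchar_Fp. Qed.

(* The simplicial coboundary of [phi], evaluated on the vertex list [s]. *)
Fixpoint deletions (T : Type) (phi : seq T -> 'F_2) (s : seq T) : 'F_2 :=
  if s is x :: s' then (phi s' + deletions (fun t => phi (x :: t)) s')%R
  else 0%R.

Lemma deletions_sum (T I : Type) (r : seq I) (phi : I -> seq T -> 'F_2) s :
  deletions (fun t => \sum_(i <- r) phi i t)%R s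
  = (\sum_(i <- r) deletions (phi i) s)%R.
Proof.
elim: s phi => [|x s IHs] phi /=; first by rewrite big1.
by rewrite IHs -big_split.
Qed.

Lemma deletions_map (T U : Type) (f : T -> U) (phi : seq U -> 'F_2) s :
  deletions (fun t => phi (map f t)) s = deletions phi (map f s).
Proof. by elim: s phi => //= x s IHs phi; rewrite -IHs. Qed.

Lemma deletions_rem (T : eqType) (phi : seq T -> 'F_2) s :
  (forall t u, perm_eq t u -> phi t = phi u) ->
  deletions phi s = (\sum_(x <- s) phi (rem x s))%R.
Proof.
elim: s phi => [|x s IHs] phi phiP /=; first by rewrite big_nil.
rewrite big_cons /= eqxx; congr (_ + _)%R; rewrite IHs; last first.
  by move=> t u tu; apply: phiP; rewrite perm_cons.
apply: eq_big_seq => y ys.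
case: eqVneq => // ->; apply: phiP.
by rewrite perm_sym; apply: perm_to_rem.
Qed.

Lemma deletions_subseq (T : eqType) (phi psi : seq T -> 'F_2) s :
  (forall t, subseq t s -> phi t = psi t) -> deletions phi s = deletions psi s.
Proof.
elim: s phi psi => // x s IHs phi psi eq_phi /=.
rewrite eq_phi ?subseq_cons //; congr (_ + _)%R; apply: IHs => t ts.
by apply: eq_phi => /=; rewrite eqxx.
Qed.

(** Alternation is read off sorted labels, so the coboundary has to pass through the sort. For a
    symmetric cochain it is a sum over deleted entries, blind to their order, and a subsequence of a
    sorted list is already sorted. *)
Lemma deletions_sort (psi : seq nat -> 'F_2) s :
  deletions (fun t => psi (sort leq t)) s = deletions psi (sort leq s).
Proof.
pose phi t := psi (sort leq t).
have phiP t u : perm_eq t u -> phi t = phi u.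
  move=> tu; congr psi; apply/perm_sortP => //.
  - exact: leq_total.
  - exact: leq_trans.
  - exact: anti_leq.
have -> : deletions phi s = deletions phi (sort leq s).
  rewrite !deletions_rem //.
  rewrite (perm_big (sort leq s)) /=; last by rewrite perm_sym perm_sort.
  apply: eq_big_seq => x; rewrite mem_sort => xs; apply: phiP.
  rewrite -(perm_cons x) -(permPl (perm_to_rem xs)) perm_sym.
  by rewrite -(permPl (perm_to_rem _)) ?mem_sort // perm_sort.
apply: deletions_subseq => t ts; congr psi; apply: sorted_sort.
  exact: leq_trans.
exact: subseq_sorted leq_trans _ _ ts (sort_sorted leq_total s).
Qed.

Fixpoint alternating (b : bool) (s : seq bool) : bool :=
  if s is x :: s' then (x == b) && alternating (~~ b) s' else true.

Definition altern (b : bool) (s : seq bool) : 'F_2 := (alternating b s)%:R%R.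

(* Fan's lemma in cochain form. *)
Lemma deletions_altern b s :
  deletions (altern b) s = (altern b s + altern (~~ b) s)%R.
Proof.
elim: s b => [|x s IHs] b /=; first by rewrite /altern addrr_F2.
have -> : deletions (fun t => altern b (x :: t)) s
    = (if x == b then deletions (altern (~~ b)) s else 0)%R.
  rewrite /altern /=; case: eqP => _ //.
  by elim: s {IHs} => //= y s ->; rewrite addr0.
rewrite /altern in IHs *.
rewrite IHs /=; case: x; case: b => /=; rewrite ?(addr0, add0r) //;
  by rewrite addrCA addrr_F2 addr0.
Qed.

(** * Cubical cells, their boundaries and their flags *)

Notation cell := (seq nat).

(* A cell of the cubical grid is a product of vertices (even entries) and
   unit edges (odd entries). *)
Fixpoint bd (F : cell) : seq cell :=
  if F is p :: F' then
    (if odd p then [:: p.-1 :: F'; p.+1 :: F'] else [::])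
      ++ [seq p :: G | G <- bd F']
  else [::].

Lemma bd_const (F : cell) (c : 'F_2) : (\sum_(G <- bd F) c = 0)%R.
Proof.
elim: F => [|p F IH] /=; first by rewrite big_nil.
rewrite big_cat big_map /= IH addr0; case: odd; rewrite ?big_nil //.
by rewrite !big_cons big_nil addr0 addrr_F2.
Qed.

Lemma bd_bd (F : cell) (h : cell -> 'F_2) :
  (\sum_(G <- bd F) \sum_(H <- bd G) h H = 0)%R.
Proof.
elim: F h => [|p F IH] h /=; first by rewrite big_nil.
rewrite big_cat big_map /=.
case: (boolP (odd p)) => p_odd; last first.
  rewrite big_nil add0r -[RHS](IH (fun H => h (p :: H))).
  by apply: eq_bigr => G _; rewrite big_map.
have p_pos : 0 < p by case: p p_odd.
have odd_pred : odd p.-1 = false by case: p p_odd {p_pos} => //= p; case: odd.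
have odd_succ : odd p.+1 = false by rewrite /= p_odd.
rewrite !big_cons big_nil addr0 /= odd_pred p_odd /= !big_map.
under [X in (_ + X)%R]eq_bigr => G _ do rewrite !big_cons !big_map.
rewrite !big_split /= (IH (fun H => h (p :: H))) addr0 !addrA.
set a := (\sum_(_ <- _) h (p.-1 :: _))%R.
set b := (\sum_(_ <- _) h (p.+1 :: _))%R.
by rewrite (addrAC a) addrr_F2 add0r addrr_F2.
Qed.

(* The sum of [beta] over the complete flags of faces of a [d]-dimensional cell
   [F], i.e. over the simplices of its barycentric subdivision, each flag being
   prepended to [acc]. *)
Fixpoint flags (beta : seq cell -> 'F_2) d (F : cell) (acc : seq cell) : 'F_2 :=
  if d is d'.+1 then (\sum_(G <- bd F) flags beta d' G (F :: acc))%R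
  else beta (F :: acc).

(** Deleting the lowest cell of a flag leaves terms that occur an even number of times ([bd_const]),
    and deleting an intermediate cell is cancelled by [bd_bd]. What remains is the deletion of the
    top cell [F], besides deletions inside [acc]. *)
Lemma flags_deletions (beta : seq cell -> 'F_2) d F acc :
  flags (deletions beta) d.+1 F acc =
  (\sum_(G <- bd F) flags beta d G acc + deletions (flags beta d.+1 F) acc)%R.
Proof.
elim: d F acc => [|d IHd] F acc.
  rewrite /= !big_split /= bd_const add0r; congr (_ + _)%R.
  by rewrite deletions_sum.
transitivity (\sum_(G <- bd F) (\sum_(H <- bd G) flags beta d H (F :: acc) +
    deletions (flags beta d.+1 G) (F :: acc)))%R.
  by apply: eq_bigr => G _; exact: IHd.
rewrite /= !big_split /= bd_bd add0r; congr (_ + _)%R.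
by rewrite deletions_sum.
Qed.

Definition coface_step (p q : nat) : bool :=
  (p == q) || odd q && ((p == q.-1) || (p == q.+1)).

Definition face (G F : cell) : bool := all2 coface_step G F.

Lemma face_refl : reflexive face.
Proof. by elim=> //= p F ->; rewrite /coface_step eqxx. Qed.

Lemma face_trans : transitive face.
Proof.
elim=> [|q F IHF] [|p G] [|r H] //= /andP[pq GF] /andP[qr FH].
rewrite (IHF _ _ GF FH) andbT.
move: pq qr; rewrite /coface_step.
case/predU1P=> [-> //|/andP[q_odd pq]] /predU1P[<-|/andP[r_odd]].
  by rewrite q_odd pq orbT.
by move=> qr; exfalso; lia.
Qed.

Lemma bd_face F G : G \in bd F -> face G F.
Proof.
elim: F G => //= p F IH G; rewrite mem_cat => /orP[|/mapP[H HF ->]] /=.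
  case: (boolP (odd p)) => // p_odd; rewrite !inE => /orP[] /eqP-> /=;
    by rewrite /coface_step p_odd eqxx ?orbT face_refl.
by rewrite /coface_step eqxx IH.
Qed.

Lemma bd_dim F G : G \in bd F -> count odd F = (count odd G).+1.
Proof.
elim: F G => //= p F IH G; rewrite mem_cat => /orP[|/mapP[H HF ->]] /=.
  case: p => [|p] //=; case: (boolP (odd p)) => //= p_odd.
  by rewrite !inE => /orP[] /eqP-> /=; rewrite ?negbK (negbTE p_odd).
by rewrite (IH _ HF) addnS.
Qed.

Definition bd_closed (Q : pred cell) := forall F G, Q F -> G \in bd F -> Q G.

Lemma flags_congr (Q : pred cell) beta beta' d F acc :
  bd_closed Q ->
  (forall s, size s = d.+1 -> all Q s -> sorted face (s ++ acc) ->
     beta (s ++ acc) = beta' (s ++ acc)) ->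
  Q F -> sorted face (F :: acc) ->
  flags beta d F acc = flags beta' d F acc.
Proof.
move=> Qbd; elim: d F acc => [|d IHd] F acc eq_beta QF Facc.
  by rewrite /= -cat1s eq_beta //= QF.
apply: eq_big_seq => G GF; apply: IHd.
- move=> s sd Qs; rewrite -cat_rcons => ss; apply: eq_beta => //.
    by rewrite size_rcons sd.
  by rewrite all_rcons QF.
- exact: Qbd GF.
- by rewrite /= bd_face.
Qed.

Lemma flags_map (Q : pred cell) (rho : cell -> cell) beta d F acc :
  bd_closed Q ->
  (forall F, Q F -> perm_eq (bd (rho F)) (map rho (bd F))) ->
  Q F ->
  flags beta d (rho F) (map rho acc) = flags (fun s =>
    beta (map rho s)) d F acc.
Proof.
move=> Qbd rhoP; elim: d F acc => //= d IHd F acc QF.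
rewrite (perm_big _ (rhoP F QF)) big_map.
by apply: eq_big_seq => G GF; rewrite -IHd //; apply: Qbd GF.
Qed.

Fixpoint coordwise (f : nat -> nat -> nat) (F : cell) : cell :=
  if F is p :: F' then f 0 p :: coordwise (fun i => f i.+1) F' else [::].

Lemma size_coordwise f F : size (coordwise f F) = size F.
Proof. by elim: F f => //= p F IH f; rewrite IH. Qed.

Lemma nth_coordwise f F i :
  i < size F -> nth 0 (coordwise f F) i = f i (nth 0 F i).
Proof.
by elim: F f i => // p F IH f [|i] //= iF; rewrite (IH (fun i => f i.+1)).
Qed.

Lemma eq_coordwise f g F :
  (forall i, i < size F -> f i (nth 0 F i) = g i (nth 0 F i)) ->
  coordwise f F = coordwise g F.
Proof.
move=> fg; apply: (@eq_from_nth _ 0); rewrite !size_coordwise // => i iF.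
by rewrite !nth_coordwise // fg.
Qed.

Lemma coordwise_coordwise f g F :
  coordwise f (coordwise g F) = coordwise (fun i p => f i (g i p)) F.
Proof. by elim: F f g => //= p F IH f g; rewrite IH. Qed.

(** The one-coordinate condition for a chain map. A reflection exchanges the two ends of an edge,
    hence the comparison up to permutation. *)
Definition cellular_at (f : nat -> nat) (p : nat) : bool :=
  if odd p then
    odd (f p) && perm_eq [:: (f p).-1; (f p).+1] [:: f p.-1; f p.+1]
  else ~~ odd (f p).

Lemma bd_coordwise f F :
  (forall i, i < size F -> cellular_at (f i) (nth 0 F i)) ->
  perm_eq (bd (coordwise f F)) (map (coordwise f) (bd F)).
Proof.
elim: F f => //= p F IH f fF; rewrite map_cat.
have := fF 0 isT; rewrite /cellular_at /=; set g := fun i => f i.+1.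
have IHF : perm_eq [seq f 0 p :: G | G <- bd (coordwise g F)]
    [seq coordwise f i | i <- [seq p :: G | G <- bd F]].
  rewrite -map_comp (_ : map _ (bd F)
    = [seq f 0 p :: G | G <- map (coordwise g) (bd F)]); last first.
    by rewrite -map_comp.
  by apply: perm_map; apply: IH => i iF; apply: (fF i.+1).
case: (boolP (odd p)) => [_ /andP[-> fp] | _ /negbTE->] //=.
by apply: perm_cat (perm_map (fun q => q :: coordwise g F) fp) IHF.
Qed.

(** * Chains on boxes of the grid and Stokes' formula modulo 2 *)

Section Box.
Variable N : nat.

(* A box is a product of pinned coordinates [Some p] and full intervals
   [None]. *)
Fixpoint box_sum (B : seq (option nat)) (h : cell -> 'F_2) : 'F_2 :=
  match B with
  | [::] => h [::]
  | None :: B' => (\sum_(u < N) box_sum B' (fun F => h (u.*2.+1 :: F)))%R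
  | Some p :: B' => box_sum B' (fun F => h (p :: F))
  end.

Fixpoint box_faces (B : seq (option nat)) : seq (seq (option nat)) :=
  match B with
  | [::] => [::]
  | None :: B' => [:: Some 0 :: B', Some N.*2 :: B' & map (cons None)
    (box_faces B')]
  | Some p :: B' => map (cons (Some p)) (box_faces B')
  end.

Definition nfree (B : seq (option nat)) := count (pred1 None) B.

Definition even_pinned (B : seq (option nat)) :=
  all (fun o => if o is Some p then ~~ odd p && (p <= N.*2) else true) B.

Definition fits (o : option nat) (p : nat) : bool :=
  if o is Some q then p == q else p <= N.*2.

Definition in_box (B : seq (option nat)) (F : cell) : bool := all2 fits B F.

Lemma in_box_bd B : even_pinned B -> bd_closed (in_box B).
Proof.
elim: B => [|o B IHB] //=; first by move=> _ [].
move=> /andP[even_o B_even] [|p F] //= G /andP[op BF].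
rewrite mem_cat => /orP[|/mapP[H HF ->]] /=; last first.
  by rewrite op (IHB B_even _ _ BF HF).
case: (boolP (odd p)) => // p_odd.
case: o op even_o => [q /= /eqP <- /andP[]|/= pN _]; first by rewrite p_odd.
by rewrite !inE => /orP[] /eqP-> /=; rewrite BF andbT; lia.
Qed.

Lemma eq_box_sum B h h' : even_pinned B ->
  (forall F, in_box B F -> count odd F = nfree B ->
     (forall j, nth (Some 0) B j = None -> odd (nth 0 F j)) -> h F = h' F) ->
  box_sum B h = box_sum B h'.
Proof.
elim: B h h' => [|[p|] B IHB] h h' /=.
- by move=> _ eq_h; apply: eq_h => // j; rewrite nth_nil.
- move=> /andP[/andP[/negbTE p_even _] B_even] eq_h.
  apply: IHB => // F BF dF Fodd; apply: eq_h.
  + by rewrite /= eqxx.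
  + by rewrite /= p_even dF.
  + by case.
move=> B_even eq_h; apply: eq_bigr => u _.
apply: IHB => // F BF dF Fodd; apply: eq_h.
- by rewrite /= BF andbT; have := ltn_ord u; lia.
- by rewrite /= odd_double dF.
- by case=> //= _; rewrite odd_double.
Qed.

Lemma box_sumD B h h' :
  box_sum B (fun F => h F + h' F)%R = (box_sum B h + box_sum B h')%R.
Proof.
elim: B h h' => [|[p|] B IHB] h h' //=.
by rewrite -big_split; apply: eq_bigr => u _; apply: IHB.
Qed.

(** A facet interior to the box belongs to two cells and cancels: along each free coordinate the sum
    telescopes modulo 2 and leaves the ends 0 and 2N. *)
Lemma box_sum_bd B h : even_pinned B ->
  box_sum B (fun F => \sum_(G <- bd F) h G)%R
  = (\sum_(B' <- box_faces B) box_sum B' h)%R.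
Proof.
elim: B h => [|[p|] B IHB] h /=; first by rewrite !big_nil.
  move=> /andP[/andP[/negbTE p_even _] B_even]; rewrite big_map -IHB //=.
  by apply: eq_box_sum => // F _ _ _ /=; rewrite p_even big_map.
move=> B_even; rewrite !big_cons big_map /=.
pose g p := box_sum B (fun F => h (p :: F)).
transitivity (\sum_(u < N) (g u.*2 + g u.+1.*2 +
   box_sum B (fun F => \sum_(G <- bd F) h (u.*2.+1 :: G))))%R.
  apply: eq_bigr => u _; rewrite /g -!box_sumD;
    apply: eq_box_sum => // F _ _ _ /=.
  by rewrite odd_double /= !big_cons big_map doubleS addrA.
rewrite big_split /= addrA; congr (_ + _)%R; last first.
  by rewrite exchange_big /=; apply: eq_bigr => u _; exact: IHB.
rewrite -/(g 0) -/(g _); elim: N => [|M IHM].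
  by rewrite big_ord0 addrr_F2.
by rewrite big_ord_recr /= IHM addrA -(addrA (g 0)) addrr_F2 addr0.
Qed.

(** The cochain [beta] evaluated on the fundamental chain of the barycentric subdivision of the
    box. *)
Definition chain_sum (beta : seq cell -> 'F_2) B : 'F_2 :=
  box_sum B (fun F => flags beta (nfree B) F [::]).

Lemma chain_sum_congr beta beta' B : even_pinned B ->
  (forall s, size s = (nfree B).+1 -> all (in_box B) s -> sorted face s ->
     beta s = beta' s) ->
  chain_sum beta B = chain_sum beta' B.
Proof.
move=> B_even eq_beta; apply: eq_box_sum => // F BF _ _.
apply: flags_congr (in_box_bd B_even) _ BF _ => // s sd Bs.
by rewrite cats0; apply: eq_beta.
Qed.

Lemma nfree_box_faces B B' : B' \in box_faces B -> nfree B = (nfree B').+1.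
Proof.
elim: B B' => // [[p|] B IHB] B' /=.
  by move=> /mapP[B1 /IHB BB1 ->]; rewrite /nfree /= -/(nfree B) BB1.
rewrite !inE => /or3P[/eqP->|/eqP->|/mapP[B1 /IHB BB1 ->]] //.
by rewrite /nfree /= -/(nfree B) BB1 addnS.
Qed.

(** Stokes' formula: [flags_deletions] with empty [acc] handles the inside of each cell,
    [box_sum_bd] the passage between cells. *)
Lemma chain_sum_deletions beta B : even_pinned B -> 0 < nfree B ->
  chain_sum (deletions beta) B
  = (\sum_(B' <- box_faces B) chain_sum beta B')%R.
Proof.
move=> B_even B_pos.
transitivity (box_sum B (fun F =>
    \sum_(G <- bd F) flags beta (nfree B).-1 G [::])%R).
  apply: eq_box_sum => // F _ _ _; rewrite -{1}(prednK B_pos) flags_deletions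
    /=.
  by rewrite addr0.
rewrite box_sum_bd //; apply: eq_big_seq => B' /nfree_box_faces BB'.
by rewrite /chain_sum BB'.
Qed.

Definition flip (c : pred nat) : cell -> cell :=
  coordwise (fun i p => if c i then N.*2 - p else p).

Fixpoint flip_box (c : pred nat) (B : seq (option nat)) : seq (option nat) :=
  if B is o :: B' then
    (if o is Some p then Some (if c 0 then N.*2 - p else p) else None)
      :: flip_box (fun i => c i.+1) B'
  else [::].

Lemma nfree_flip_box c B : nfree (flip_box c B) = nfree B.
Proof. by rewrite /nfree; elim: B c => //= [[p|] B] IHB c; rewrite /= IHB. Qed.

Lemma in_box_le B F i : even_pinned B -> in_box B F -> nth 0 F i <= N.*2.
Proof.
elim: B F i => [|o B IHB] [|p F] [|i] //= /andP[even_o B_even] /andP[op BF].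
  by case: o op even_o => [q /eqP-> /andP[] |].
exact: IHB.
Qed.

Lemma bd_flip c B F : even_pinned B -> in_box B F ->
  perm_eq (bd (flip c F)) (map (flip c) (bd F)).
Proof.
move=> B_even BF; apply: bd_coordwise => i _.
have := in_box_le i B_even BF; set p := nth 0 F i; rewrite /cellular_at.
case: (c i); last by case: odd => //=.
move=> pN; case: (boolP (odd p)) => p_odd; last by lia.
have -> /= : odd (N.*2 - p) by lia.
have -> : (N.*2 - p).-1 = N.*2 - p.+1 by lia.
have -> : (N.*2 - p).+1 = N.*2 - p.-1 by lia.
by rewrite (perm_catC [:: _] [:: _]).
Qed.

Lemma box_sum_flip c B h : even_pinned B ->
  box_sum (flip_box c B) h = box_sum B (fun F => h (flip c F)).
Proof.
rewrite /flip; elim: B c h => [|[p|] B IHB] c h //=.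
  by move=> /andP[_ B_even]; rewrite IHB.
move=> B_even; under eq_bigr => u _ do rewrite IHB //.
case: (c 0) => //; rewrite (reindex_inj rev_ord_inj) /=.
apply: eq_bigr => u _; apply: eq_box_sum => // F _ _ _.
by congr (h (_ :: _)); have := ltn_ord u; lia.
Qed.

Lemma chain_sum_flip c beta B : even_pinned B ->
  chain_sum beta (flip_box c B) = chain_sum (fun s => beta (map (flip c) s)) B.
Proof.
move=> B_even; rewrite /chain_sum nfree_flip_box box_sum_flip //.
apply: eq_box_sum => // F BF _ _.
apply: (@flags_map (in_box B) (flip c) beta _ F [::] (in_box_bd B_even)) => //.
by move=> G BG; apply: bd_flip BG.
Qed.

Definition set_coord j q : cell -> cell :=
  coordwise (fun i p => if i == j then q else p).

Lemma sum_bd_even (F : cell) j (h : cell -> 'F_2) : odd (nth 0 F j) ->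
  (\sum_(G <- bd F | ~~ odd (nth 0 G j)) h G)%R
  = (h (set_coord j (nth 0 F j).-1 F) + h (set_coord j (nth 0 F j).+1 F))%R.
Proof.
have coord_id F' : coordwise (fun _ p => p) F' = F'.
  by elim: F' => //= p F' ->.
rewrite /set_coord; elim: F j h => [|p F IH] [|j] h //= p_odd.
  rewrite p_odd big_cat big_map /= !big_cons big_nil /= p_odd /=.
  have -> /= : ~~ odd p.-1 by case: p p_odd => //= p; rewrite negbK.
  by rewrite addr0 big1 ?addr0 ?coord_id // => G; rewrite p_odd.
rewrite big_cat big_map /= IH // big1_seq ?add0r // => G /andP[Gj].
by case: odd => //; rewrite !inE => /orP[] /eqP G_eq; move: Gj;
  rewrite G_eq /= p_odd.
Qed.

Lemma in_box_set_coord B F j q : in_box B F -> nth (Some 0) B j = None ->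
  q <= N.*2 -> in_box B (set_coord j q F).
Proof.
rewrite /set_coord; elim: B F j => [|o B IHB] [|p F] [|j] //= /andP[op BF] Bj
  qN.
  rewrite Bj /= qN /= (_ : coordwise _ F = F) //.
  by elim: F {BF} => //= r F ->.
by rewrite op /=; apply: IHB.
Qed.

Lemma set_coord_set_coord j q r F :
  set_coord j q (set_coord j r F) = set_coord j q F.
Proof.
by rewrite /set_coord coordwise_coordwise; apply: eq_coordwise => i _ /=;
  case: (i == j).
Qed.

Lemma bd_set_coord j q F : ~~ odd q -> ~~ odd (nth 0 F j) ->
  perm_eq (bd (set_coord j q F)) (map (set_coord j q) (bd F)).
Proof.
move=> q_even Fj; apply: bd_coordwise => i _; rewrite /cellular_at.
case: (eqVneq i j) => [->|_] /=; first by rewrite (negbTE Fj).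
by case: odd; rewrite ?perm_refl.
Qed.

(* The two faces [j -/+ 1] of a cell carry the same labels, so the flags
   cancel in pairs. *)
Lemma flags_degenerate B j beta d F acc : even_pinned B ->
  nth (Some 0) B j = None ->
  (forall s, all (in_box B) s -> beta (map (set_coord j 0) s) = beta s) ->
  in_box B F -> all (in_box B) acc -> odd (nth 0 F j) -> count odd F = d ->
  flags beta d F acc = 0%R.
Proof.
move=> B_even Bj beta_j; elim: d F acc => [|d IHd] F acc BF Bacc Fj dF.
  have : ~~ has odd F by rewrite has_count dF.
  by rewrite -all_predC => /all_nthP/(_ j); case: ltnP => [_ /(_ 0 isT)|jF _];
    [rewrite /= Fj|rewrite nth_default in Fj].
rewrite /= (bigID (fun G => odd (nth 0 G j))) /= big1_seq ?add0r; last first.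
  move=> G /andP[Gj GF]; apply: IHd => //.
  - exact: in_box_bd GF.
  - by rewrite /= BF.
  - by have := bd_dim GF; rewrite dF => -[].
rewrite sum_bd_even //.
pose Q G := in_box B G && ~~ odd (nth 0 G j).
have Qbd : bd_closed Q.
  move=> G H /andP[BG Gj] HG; rewrite /Q (in_box_bd B_even BG HG) /=.
  have := bd_face HG; elim: H G j Gj {Q Bj beta_j Fj IHd BG HG} =>
    [|q H IH] [|p G] [|j] //= Gj.
    by rewrite /coface_step (negbTE Gj) orbF => /andP[/eqP->].
  by move=> /andP[_ /IH]; apply.
have flags_set G : Q G ->
    flags beta d G (F :: acc)
    = flags beta d (set_coord j 0 G) (map (set_coord j 0) (F :: acc)).
  move=> QG; rewrite (@flags_map Q) //; last first.
    by move=> H /andP[_ Hj]; apply: bd_set_coord.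
  have: all (in_box B) (F :: acc) by rewrite /= BF.
  move: (F :: acc) {Bacc BF Fj dF IHd} => {F}acc Bacc.
  elim: d G QG acc Bacc => [|d IHd] G QG acc Bacc /=.
    by rewrite -beta_j //= Bacc andbT; case/andP: QG.
  apply: eq_big_seq => H HG; apply: IHd; first exact: Qbd HG.
  by rewrite /= Bacc andbT; case/andP: QG.
have jF : j < size F by case: ltnP => // jF; rewrite nth_default in Fj.
have Fj2 := in_box_le j B_even BF.
have Q_set q : ~~ odd q -> q <= N.*2 -> Q (set_coord j q F).
  move=> q_even qN; apply/andP; split; first exact: in_box_set_coord.
  by rewrite nth_coordwise // eqxx.
move: Fj Fj2; move: (nth 0 F j) => p p_odd p_le.
rewrite !flags_set ?set_coord_set_coord ?addrr_F2 //; apply: Q_set.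
- by rewrite /= negbK.
- by lia.
- by case: p p_odd {p_le} => //= p.
- by lia.
Qed.

(** This disposes of the faces of the cube that the parametrization collapses along a free
    coordinate. *)
Lemma chain_sum_degenerate B j beta : even_pinned B ->
  nth (Some 0) B j = None ->
  (forall s, all (in_box B) s -> beta (map (set_coord j 0) s) = beta s) ->
  chain_sum beta B = 0%R.
Proof.
move=> B_even Bj beta_j.
have sum0 B' : box_sum B' (fun _ => 0%R) = 0%R.
  by elim: B' => [|[p|] B' IHB] //=; rewrite big1.
rewrite /chain_sum -[RHS](sum0 B); apply: eq_box_sum => // F BF dF /(_ _ Bj) Fj.
by apply: (flags_degenerate B_even Bj beta_j).
Qed.

End Box.

(** * Signed labels and alternation *)

Lemma nth_alternating b v i :
  alternating b v -> i < size v -> nth false v i = b (+) odd i.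
Proof.
elim: v b i => // x v IHv b [|i] /= /andP[/eqP xb v_alt] iv.
  by rewrite xb addbF.
by rewrite (IHv (~~ b)) // addNb addbN.
Qed.

Lemma alternating_negb b v : alternating b (map negb v) = alternating (~~ b) v.
Proof. by elim: v b => //= x v IHv b; rewrite IHv; case: x; case: b. Qed.

Lemma sorted_ltn_iota s n : sorted ltn s -> size s = n -> all (gtn n) s ->
  s = iota 0 n.
Proof.
move=> s_sorted s_size s_lt; apply: (@sorted_eq _ leq leq_trans anti_leq).
- by move: s_sorted; rewrite ltn_sorted_uniq_leq => /andP[].
- exact: iota_sorted.
have s_uniq : uniq s by move: s_sorted; rewrite ltn_sorted_uniq_leq => /andP[].
apply: uniq_perm => //; first exact: iota_uniq.
have sub : {subset s <= iota 0 n} by move=> x /(allP s_lt); rewrite mem_iota.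
by have [] := uniq_min_size s_uniq sub; rewrite ?size_iota ?s_size.
Qed.

(* A pair of labels [(a, b)] with [a != b] stands for [e_a - e_b]; it is
   encoded by [min a b] and a sign. *)
Definition signed_label (x : nat * nat) : nat :=
  if x.1 < x.2 then x.1.*2 else x.2.*2.+1.

(* The factor [(-1)^i] makes the all-positive labelling [0, 1, .., n - 1]
   alternating. *)
Definition twisted_sign (x : nat) : bool := ~~ odd x./2 (+) odd x.

Definition alternates b (t : seq nat) : bool :=
  alternating b (map twisted_sign (sort leq t)).

(** Holds for the label pairs of a boundary simplex, because the label at one vertex differs from
    the label at the antipode of any other. *)
Definition separated (s : seq (nat * nat)) : Prop :=
  forall x y : nat * nat, x \in s -> y \in s -> x.1 != y.2.

Definition swap_pair (x : nat * nat) := (x.2, x.1).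

Lemma signed_label_half x : x.1 != x.2 -> (signed_label x)./2 = minn x.1 x.2.
Proof. by rewrite /signed_label; case: ltnP; lia. Qed.

Lemma separated_half s (x y : nat * nat) : separated s -> x \in s -> y \in s ->
  (signed_label x)./2 = (signed_label y)./2 -> signed_label x = signed_label y.
Proof.
move=> s_sep xs ys; move: (s_sep x y xs ys) (s_sep y x ys xs) (s_sep x x xs xs).
move: (s_sep y y ys ys); rewrite /signed_label.
by case: ltnP => ?; case: ltnP => ?; lia.
Qed.

(** Swapping toggles the lowest bit of each signed label. By [separated_half], two labels that
    differ only in this bit never both occur, so the toggle preserves the sorted order and just
    reverses every sign. *)
Lemma alternates_swap b s : separated s ->
  alternates b (map signed_label (map swap_pair s))
  = alternates (~~ b) (map signed_label s).
Proof.
move=> s_sep; pose sw x := if odd x then x.-1 else x.+1.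
have sw_label (x : nat * nat) : x \in s -> signed_label (swap_pair x) = sw
  (signed_label x).
  move=> xs; have := s_sep x x xs xs; rewrite /signed_label /sw /=.
  by case: ltnP => ?; case: ltnP => ?; case: ifP; lia.
set t := map signed_label s.
have -> : map signed_label (map swap_pair s) = map sw t.
  by rewrite -!map_comp; apply/eq_in_map => x xs; exact: sw_label.
have t_half : {in t &, forall x y, x./2 = y./2 -> x = y}.
  by move=> _ _ /mapP[x xs ->] /mapP[y ys ->];
    exact: (separated_half s_sep xs ys).
rewrite /alternates; have -> : sort leq (map sw t) = map sw (sort leq t).
  apply: (@sorted_eq _ leq leq_trans anti_leq).
  - exact: sort_sorted leq_total _.
  - apply: (@homo_sorted_in _ _ (mem t) sw leq leq).
    + move=> x y xt yt xy; have := t_half x y xt yt; rewrite /sw.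
      by do 2 case: ifP; lia.
    + by apply/allP => x; rewrite mem_sort.
    + exact: sort_sorted leq_total _.
  - by rewrite perm_sort perm_map // perm_sym perm_sort.
rewrite -alternating_negb -!map_comp; congr alternating.
apply: eq_map => x; rewrite /= /twisted_sign /sw.
case: ifP => x_odd.
  have -> : x.-1./2 = x./2 by lia.
  have -> : odd x.-1 = false by lia.
  by rewrite addbF addbT negbK.
have -> : x.+1./2 = x./2 by lia.
by rewrite /= x_odd addbT addbF.
Qed.

(** The bridge from Sperner's count to Fan's. If the first entries are 0, .., n - 1, separation
    forces every second entry to be n, so all signs are positive. Conversely, equal minima carry
    equal signs, so alternation makes the n minima distinct; all being below n, they are 0, .., n -
    1, and the twist then forces positive signs throughout. *)
Lemma perm_iota_alternates n s : separated s ->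
  size s = n -> all (fun x => (x.1 <= n) && (x.2 <= n)) s ->
  perm_eq (map fst s) (iota 0 n) = alternates true (map signed_label s).
Proof.
move=> s_sep s_size s_le; set t := map signed_label s.
have double_sorted : sorted leq (map double (iota 0 n)).
  by rewrite sorted_map (eq_sorted leq_double) iota_sorted.
apply/idP/idP => [s_perm|s_alt].
  have s_snd x : x \in s -> x.2 = n.
    move=> xs; have /andP[_] := allP s_le _ xs;
      rewrite leq_eqVlt => /predU1P[//|xn].
    have : x.2 \in map fst s by rewrite (perm_mem s_perm) mem_iota.
    by move=> /mapP[y ys xy]; have := s_sep y x ys xs; rewrite xy eqxx.
  have t_eq : t = map double (map fst s).
    rewrite /t -map_comp; apply/eq_in_map => x xs; rewrite /signed_label.
    have x1 : x.1 \in iota 0 n by rewrite -(perm_mem s_perm) map_f.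
    by move: x1; rewrite mem_iota /= (s_snd x xs) => ->.
  have t_sort : sort leq t = map double (iota 0 n).
    apply: (@sorted_eq _ leq leq_trans anti_leq) => //.
      exact: sort_sorted leq_total _.
    by rewrite perm_sort t_eq perm_map.
  rewrite /alternates t_sort -map_comp.
  have : forall a k, alternating (~~ odd a) (map (twisted_sign \o double) (iota
    a k)).
    move=> a k; elim: k a => //= k IHk a.
    rewrite -[~~ ~~ odd a]/(~~ odd a.+1) IHk andbT.
    by rewrite /twisted_sign doubleK odd_double addbF.
  exact.
have t_half : {in t &, forall x y, x./2 = y./2 -> x = y}.
  by move=> _ _ /mapP[x xs ->] /mapP[y ys ->];
    exact: (separated_half s_sep xs ys).
set u := sort leq t.
have u_size : size u = n by rewrite size_sort size_map.
have u_lt : all (gtn n) (map half u).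
  apply/allP => _ /mapP[x + ->]; rewrite mem_sort => /mapP[y ys ->].
  have /andP[y1 y2] := allP s_le _ ys; have yy := s_sep y y ys ys.
  by rewrite signed_label_half //=; lia.
have u_half : map half u = iota 0 n.
  apply: sorted_ltn_iota => //; last by rewrite size_map.
  have : sorted leq u by exact: sort_sorted leq_total _.
  have : {subset u <= t} by move=> x; rewrite mem_sort.
  move: s_alt; rewrite /alternates -/u; clear -t_half; move: true.
  elim: u => [|x [|y u] IHu] b //= /and3P[/eqP sx /eqP sy u_alt] u_t /andP[xy
    y_u].
  apply/andP; split; last first.
    apply: (IHu (~~ b)) => //=; first by rewrite sy eqxx u_alt.
    by move=> z zu; apply: u_t; rewrite inE zu orbT.
  have : x != y by apply: contraTneq isT => xy'; move: sy; rewrite -xy' sx;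
    case: (b).
  have := t_half x y; rewrite !u_t ?inE ?eqxx ?orbT // => /(_ isT isT).
  by lia.
have u_eq : u = map double (iota 0 n).
  apply: (@eq_from_nth _ 0) => [|i iu]; first by rewrite size_map size_iota.
  have i_half : (nth 0 u i)./2 = i.
    by rewrite -(nth_map 0 0 half) // u_half nth_iota ?add0n // -u_size.
  have := nth_alternating s_alt; rewrite size_map -/u => /(_ i iu).
  rewrite (nth_map 0) // /twisted_sign i_half (nth_map 0);
    last by rewrite size_iota -u_size.
  rewrite nth_iota -?u_size // add0n => i_odd.
  have : odd (nth 0 u i) = false by move: i_odd; do 2 case: odd.
  by move: i_half; lia.
have s_fst x : x \in s -> signed_label x = x.1.*2.
  move=> xs; have : signed_label x \in u by rewrite mem_sort map_f.
  rewrite u_eq => /mapP[i _]; rewrite /signed_label; case: ifP => // _ odd_eq.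
  by have := congr1 odd odd_eq; rewrite /= !odd_double.
have double_inj : injective double by move=> x y; lia.
apply: (perm_map_inj double_inj); rewrite -u_eq -map_comp perm_sym.
rewrite (_ : map _ s = t) ?perm_sort //.
by apply/eq_in_map => x xs; rewrite /= s_fst.
Qed.

Lemma big_box_faces N B (g : seq (option nat) -> 'F_2) :
  (\sum_(B' <- box_faces N B) g B' = \sum_(i < size B | nth (Some 0) B i ==
    None)
    (g (set_nth None B i (Some 0)) + g (set_nth None B i (Some N.*2))))%R.
Proof.
elim: B g => [|o B IHB] g; first by rewrite big_nil big_ord0.
rewrite [RHS]big_mkcond big_ord_recl /= -big_mkcond /=.
case: o => [p|] /=; last by rewrite !big_cons big_map IHB addrA.
by rewrite add0r big_map IHB.
Qed.

(** * Skeleta of the cube and cancellation of faces *)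

Section Cube.
Variables (N n m : nat).

Definition valid_cell (F : cell) := (size F == n) && all (geq N.*2) F.

Definition extremal p := (p == 0) || (p == N.*2).

(** The coordinates below [m] give the line R v, those from [m] to [n - 2] a direction in the fibre,
    and [n - 1] is a signed radius, so that reversing it sends x to - x. *)
Notation antipode := (flip N (pred1 n.-1)).

(* The cells with free coordinates [0, .., j - 1], the others being pinned at
   the end point 1. Modulo 2 and modulo the symmetries of the labelling, the
   boundary of [skeleton_box j.+1] is [skeleton_box j] plus its antipode. *)
Definition skeleton_box j : seq (option nat) :=
  mkseq (fun l => if l < j then None else Some N.*2) n.

Definition skeleton_face j i e : seq (option nat) :=
  mkseq (fun l => if l == i then Some e else if l <= j then None else Some
    N.*2) n.

Lemma size_flip_box c B : size (flip_box N c B) = size B.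
Proof. by elim: B c => //= o B IHB c; rewrite IHB. Qed.

Lemma nth_flip_box c B l : l < size B ->
  nth None (flip_box N c B) l =
  if nth None B l is Some p then Some (if c l then N.*2 - p else p) else None.
Proof. by elim: B c l => //= o B IHB c [|l] //= lB; rewrite IHB. Qed.

Lemma even_pinned_nth B :
  (forall l p, l < size B -> nth None B l = Some p -> ~~ odd p && (p <= N.*2))
    ->
  even_pinned N B.
Proof.
move=> B_even; apply/(all_nthP None) => l lB.
by case: nth (B_even l) => // p /(_ p lB erefl).
Qed.

Lemma even_pinned_skeleton_box j : even_pinned N (skeleton_box j).
Proof.
apply: even_pinned_nth => l p; rewrite size_mkseq => ln; rewrite nth_mkseq //.
by case: ifP => // _ [<-]; rewrite odd_double leqnn.
Qed.

Lemma even_pinned_skeleton_face j i e : extremal e ->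
  even_pinned N (skeleton_face j i e).
Proof.
move=> e_ext; apply: even_pinned_nth => l p; rewrite size_mkseq => ln.
rewrite nth_mkseq //; case: ifP => [_ [<-]|_].
  by move: e_ext; rewrite /extremal; lia.
by case: ifP => // _ [<-]; rewrite odd_double leqnn.
Qed.

Lemma in_boxP B F : in_box N B F ->
  size F = size B /\ forall l, l < size B ->
    if nth None B l is Some p then nth 0 F l = p else nth 0 F l <= N.*2.
Proof.
elim: B F => [|o B IHB] [|p F] //= /andP[op /IHB[-> BF]]; split => // -[_|l].
  by case: o op => //= q /eqP.
exact: BF.
Qed.

Lemma in_box_valid B F : even_pinned N B -> size B = n -> in_box N B F ->
  valid_cell F.
Proof.
move=> B_even Bn BF; have [F_size _] := in_boxP BF.
rewrite /valid_cell F_size Bn eqxx; apply/(all_nthP 0) => l _.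
exact: in_box_le BF.
Qed.

Lemma size_skeleton_box j : size (skeleton_box j) = n.
Proof. exact: size_mkseq. Qed.

Lemma nfree_skeleton_box j : j <= n -> nfree (skeleton_box j) = j.
Proof.
move=> jn; rewrite /nfree count_map.
rewrite (eq_count (a2 := gtn j)); last by move=> l /=; case: ltnP.
by rewrite -size_filter (filter_iota_ltn 0) // size_iota.
Qed.

Lemma skeleton_faces beta j : j < n ->
  chain_sum N (deletions beta) (skeleton_box j.+1)
  = (\sum_(i < j.+1) (chain_sum N beta (skeleton_face j i 0)
      + chain_sum N beta (skeleton_face j i N.*2)))%R.
Proof.
move=> jn; rewrite chain_sum_deletions ?nfree_skeleton_box //; last first.
  exact: even_pinned_skeleton_box.
rewrite big_box_faces size_skeleton_box.
have set_face (i : 'I_n) e : i < j.+1 ->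
    set_nth None (skeleton_box j.+1) i (Some e) = skeleton_face j i e.
  move=> ij; apply: (@eq_from_nth _ None).
    by rewrite size_set_nth !size_mkseq; apply/maxn_idPr.
  move=> l; rewrite size_set_nth size_mkseq (maxn_idPr _) // => ln.
  by rewrite nth_set_nth /= !nth_mkseq //; case: eqP.
rewrite (eq_bigl (fun i : 'I_n => i < j.+1)); last first.
  by move=> i; rewrite nth_mkseq //; case: ltnP.
rewrite -(big_ord_narrow (F := fun i : 'I_n =>
  (chain_sum N beta (skeleton_face j i 0)
  + chain_sum N beta (skeleton_face j i N.*2))%R) jn).
by apply: eq_bigr => i ij; rewrite !set_face.
Qed.

Lemma skeleton_face_top j : j < n -> skeleton_face j j N.*2 = skeleton_box j.
Proof.
move=> jn; apply: (@eq_from_nth _ None); rewrite !size_mkseq // => l ln.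
by rewrite !nth_mkseq //; case: ltngtP.
Qed.

Lemma flip_skeleton_face (c : pred nat) j i : j < n -> i <= j -> c i ->
  (forall l, j < l < n -> ~~ c l) ->
  flip_box N c (skeleton_face j i N.*2) = skeleton_face j i 0.
Proof.
move=> jn ij ci c_top; apply: (@eq_from_nth _ None).
  by rewrite size_flip_box !size_mkseq.
rewrite size_flip_box size_mkseq => l ln.
rewrite nth_flip_box ?size_mkseq // !nth_mkseq //.
case: eqVneq => [->|_]; first by rewrite ci subnn.
by case: (leqP l j) => // jl; rewrite (negbTE (c_top l _)) // jl.
Qed.

Section Cancellation.
Variables (T : Type) (L : cell -> T).

(** These two hypotheses state abstractly how spherical coordinates collapse and identify faces of
    the cube; they are later met through [update_degenerate] and [update_base]. *)
Hypothesis L_degenerate : forall i j q F, valid_cell F -> i < j ->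
  (j < m) || (m <= i) && (j < n.-1) -> extremal (nth 0 F i) -> q <= N.*2 ->
  L (set_coord j q F) = L F.

Hypothesis L_flip : forall i F, valid_cell F -> i < m -> extremal (nth 0 F i) ->
  L (flip N (fun l => (l <= i) || (l == m)) F) = L F.

(** If a later coordinate of the block of [i] is free, both faces collapse along it and contribute
    0. Otherwise [i] ends its block, [i = m - 1] or [i = n - 2], and a label-preserving reflection
    exchanges the two faces. *)
Lemma face_cancel (phi : seq T -> 'F_2) i j : m < n -> i < j -> j < n ->
  (j = n.-1 -> forall F, valid_cell F -> extremal (nth 0 F n.-2) ->
     m <= n.-2 -> L (flip N (leq m) F) = L F) ->
  (chain_sum N (fun s => phi (map L s)) (skeleton_face j i 0)
   + chain_sum N (fun s => phi (map L s)) (skeleton_face j i N.*2) = 0)%R.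
Proof.
move=> mn ij jn L_top; set beta := fun s => phi (map L s).
have i_n : i < n by exact: ltn_trans ij jn.
have valid e F : extremal e -> in_box N (skeleton_face j i e) F -> valid_cell F.
  move=> e_ext; apply: in_box_valid; last exact: size_mkseq.
  exact: even_pinned_skeleton_face.
have ext e F : extremal e -> in_box N (skeleton_face j i e) F ->
    extremal (nth 0 F i).
  move=> e_ext /in_boxP[_ /(_ i)]; rewrite size_mkseq nth_mkseq // eqxx.
  by move=> ->.
have ext0 : extremal 0 by [].
have ext2 : extremal N.*2 by rewrite /extremal eqxx orbT.
have degenerate l : i < l -> l <= j -> (l < m) || (m <= i) && (l < n.-1) ->
    forall e, extremal e -> chain_sum N beta (skeleton_face j i e) = 0%R.
  move=> il lj lm e e_ext; apply: (@chain_sum_degenerate N _ l).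
  - exact: even_pinned_skeleton_face.
  - rewrite nth_mkseq ?lj; last exact: leq_ltn_trans lj jn.
    by rewrite gtn_eqF.
  move=> s s_box; rewrite /beta -map_comp; congr phi; apply/eq_in_map.
  move=> F /(allP s_box) BF; apply: (L_degenerate (i := i)) => //.
    exact: valid BF.
  exact: ext BF.
have mirror (c : pred nat) : c i -> (forall l, j < l < n -> ~~ c l) ->
    (forall F, in_box N (skeleton_face j i N.*2) F -> L (flip N c F) = L F) ->
    (chain_sum N beta (skeleton_face j i 0)
     + chain_sum N beta (skeleton_face j i N.*2) = 0)%R.
  move=> ci c_top Lc; rewrite -(flip_skeleton_face jn (ltnW ij) ci c_top).
  have B_even := even_pinned_skeleton_face j i ext2.
  rewrite chain_sum_flip // (@chain_sum_congr N _ beta) ?addrr_F2 //.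
  move=> s _ s_box _; rewrite /beta -map_comp; congr phi; apply/eq_in_map.
  by move=> F /(allP s_box); exact: Lc.
have [jm|mj] := ltnP j m.
  by rewrite !(degenerate j) ?leqnn ?jm ?addr0.
have [im|mi] := ltnP i m.
  have [im1|m1i] := ltnP i m.-1.
    by rewrite !(degenerate m.-1) ?addr0 //; lia.
  apply: (mirror (fun l => (l <= i) || (l == m))) => [|l /andP[jl _]|F BF].
  - by rewrite leqnn.
  - lia.
  - by apply: L_flip => //; [exact: valid BF | exact: ext BF].
have [jn1|n1j] := ltnP j n.-1.
  by rewrite !(degenerate j) ?leqnn ?jn1 ?mi ?orbT ?addr0.
have j_eq : j = n.-1 by lia.
have [in2|n2i] := ltnP i n.-2.
  by rewrite !(degenerate n.-2) ?addr0 //; lia.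
have i_eq : i = n.-2 by lia.
apply: (mirror (leq m)) => //; first by move=> l; lia.
move=> F BF; apply: L_top => //; last by lia.
  exact: valid BF.
by rewrite -i_eq; exact: ext BF.
Qed.

End Cancellation.

Lemma flip_comp c d F :
  flip N c (flip N d F) = flip N d (flip N c F).
Proof.
rewrite /flip !coordwise_coordwise; apply: eq_coordwise => l _ /=.
by case: (c l); case: (d l).
Qed.

Lemma flipK c F : valid_cell F -> flip N c (flip N c F) = F.
Proof.
move=> /andP[/eqP F_size F_le]; apply: (@eq_from_nth _ 0).
  by rewrite !size_coordwise.
rewrite !size_coordwise => l lF; rewrite !nth_coordwise ?size_coordwise //.
by case: (c l) => //; rewrite subKn //; exact: (all_nthP 0 F_le).
Qed.

Lemma nth_flip c F l : valid_cell F -> l < n ->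
  nth 0 (flip N c F) l = if c l then N.*2 - nth 0 F l else nth 0 F l.
Proof. by move=> /andP[/eqP F_size _] ln; rewrite nth_coordwise ?F_size. Qed.

Lemma valid_flip c F : valid_cell F -> valid_cell (flip N c F).
Proof.
move=> F_valid; have /andP[/eqP F_size F_le] := F_valid.
rewrite /valid_cell size_coordwise F_size eqxx; apply/(all_nthP 0) => l.
rewrite size_coordwise F_size => ln; rewrite /= nth_flip //.
have : nth 0 F l <= N.*2 by apply: (all_nthP 0 F_le); rewrite F_size.
by case: (c l); lia.
Qed.

Lemma extremal_flip c F l : valid_cell F -> l < n -> extremal (nth 0 F l) ->
  extremal (nth 0 (flip N c F) l).
Proof. by move=> F_valid ln; rewrite nth_flip // /extremal; case: (c l);
  lia. Qed.

Lemma set_coord_flip (c : pred nat) j q F : ~~ c j ->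
  set_coord j q (flip N c F) = flip N c (set_coord j q F).
Proof.
move=> cj; rewrite /flip /set_coord !coordwise_coordwise.
by apply: eq_coordwise => l _ /=; case: eqVneq => [->|//]; rewrite (negbTE cj).
Qed.

(** * Counting doors on the cube and alternating simplices on its skeleta *)

Section Labelling.
Variable lab : cell -> nat.

Hypothesis mn : m < n.
Hypothesis lab_le : forall F, valid_cell F -> lab F <= n.

Hypothesis lab_degenerate : forall i j q F, valid_cell F -> i < j ->
  (j < m) || (m <= i) && (j < n.-1) -> extremal (nth 0 F i) -> q <= N.*2 ->
  lab (set_coord j q F) = lab F.

Hypothesis lab_flip_base : forall i F, valid_cell F -> i < m ->
  extremal (nth 0 F i) ->
  lab (flip N (fun l => (l <= i) || (l == m)) F) = lab F.

Hypothesis lab_flip_fibre : forall i F, valid_cell F -> m <= i < n.-1 ->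
  extremal (nth 0 F i) ->
  lab (flip N (fun l => m <= l <= i) F) = lab (antipode F).

Hypothesis lab_antipode : forall F G, valid_cell F -> valid_cell G ->
  nth 0 F n.-1 = N.*2 -> nth 0 G n.-1 = N.*2 -> face F G || face G F ->
  lab F != lab (antipode G).

Definition label_pair F := (lab F, lab (antipode F)).

Definition alternation b (s : seq cell) : 'F_2 :=
  (alternates b (map signed_label (map label_pair s)))%:R%R.

Definition hemisphere j l : bool := if j < m then l <= j else m <= l <= j.

Let n_gt0 : 0 < n. Proof. exact: leq_ltn_trans mn. Qed.

Let pred_n : n.-1 < n. Proof. by rewrite prednK. Qed.

(** For [j < m] the reflection replaces v by - v. [lab_flip_base] trades this for the reflection of
    coordinate [m] alone. That coordinate is the radius when [m = n - 1]; otherwise it is extremal,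
    and [lab_flip_fibre] turns its reflection into the antipode. *)
Lemma flip_hemisphere j F : j < n.-1 -> valid_cell F -> extremal (nth 0 F j) ->
  (j < m -> extremal (nth 0 F m)) ->
  lab (flip N (hemisphere j) F) = lab (antipode F).
Proof.
move=> jn F_valid Fj; rewrite /hemisphere.
case: ltnP => [jm /(_ isT) Fm|mj _]; last by apply: lab_flip_fibre; rewrite ?mj.
have jn' : j < n := ltn_trans jm mn.
have F'_valid := valid_flip (pred1 m) F_valid.
have := lab_flip_base F'_valid jm (extremal_flip _ F_valid jn' Fj).
have -> : flip N (fun l => (l <= j) || (l == m)) (flip N (pred1 m) F)
    = flip N (fun l => l <= j) F.
  have /andP[/eqP F_size F_le] := F_valid.
  rewrite /flip coordwise_coordwise; apply: eq_coordwise => l lF /=.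
  case: (eqVneq l m) => [l_eq|_]; last by rewrite orbF.
  rewrite orbT l_eq leqNgt jm subKn //; apply: (all_nthP 0 F_le).
  by rewrite F_size.
move=> ->; have [m_eq|m_neq] := eqVneq m n.-1; first by rewrite m_eq.
have mn1 : m < n.-1 by move: mn; lia.
rewrite -(lab_flip_fibre F_valid _ Fm) ?leqnn //; congr lab.
by apply: eq_coordwise => l _ /=; rewrite -eqn_leq eq_sym.
Qed.

Lemma label_pair_hemisphere j F : j < n.-1 -> valid_cell F ->
  extremal (nth 0 F j) -> (j < m -> extremal (nth 0 F m)) ->
  label_pair (flip N (hemisphere j) F) = swap_pair (label_pair F).
Proof.
move=> jn F_valid Fj Fm; rewrite /label_pair /swap_pair flip_comp.
have jn' : j < n by apply: ltn_trans jn _.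
rewrite !flip_hemisphere //; first by rewrite flipK.
- exact: valid_flip.
- exact: extremal_flip.
- by move=> jm; apply: extremal_flip => //; exact: Fm.
Qed.

Lemma face_or s F G : sorted face s -> F \in s -> G \in s ->
  face F G || face G F.
Proof.
move=> s_sorted; elim: s s_sorted => // H s IHs /= s_path.
have := order_path_min face_trans s_path => /allP H_min.
rewrite !inE => /predU1P[->|Fs] /predU1P[->|Gs].
- by rewrite face_refl.
- by rewrite H_min.
- by rewrite (H_min F) ?orbT.
- by apply: IHs => //; exact: path_sorted s_path.
Qed.

Lemma separated_labels j s : j <= n.-1 -> all (in_box N (skeleton_box j)) s ->
  sorted face s -> separated (map label_pair s).
Proof.
move=> jn s_box s_sorted _ _ /mapP[F Fs ->] /mapP[G Gs ->] /=.
have box_last H : H \in s -> valid_cell H /\ nth 0 H n.-1 = N.*2.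
  move=> /(allP s_box) BH; split.
    by apply: in_box_valid BH; rewrite ?size_skeleton_box
      ?even_pinned_skeleton_box.
  have [_ /(_ n.-1)] := in_boxP BH; rewrite size_skeleton_box => /(_ pred_n).
  by rewrite nth_mkseq // ltnNge jn /= => ->.
have [F_valid F_last] := box_last F Fs; have [G_valid G_last] := box_last G Gs.
by apply: lab_antipode => //; exact: face_or s_sorted Fs Gs.
Qed.

Lemma flip_skeleton_box j (c : pred nat) : j < n -> c j ->
  (forall l, j < l < n -> ~~ c l) ->
  flip_box N c (skeleton_box j) = skeleton_face j j 0.
Proof.
by move=> jn cj c_top; rewrite -(skeleton_face_top jn) flip_skeleton_face.
Qed.

(** The reflection [hemisphere j] carries the skeleton onto the opposite facet and swaps the entries
    of each label pair, which exchanges the two kinds of alternation. *)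
Lemma chain_sum_alternation_bottom b j : j < n.-1 ->
  chain_sum N (alternation b) (skeleton_face j j 0)
  = chain_sum N (alternation (~~ b)) (skeleton_box j).
Proof.
move=> jn; have jn' : j < n by apply: ltn_trans jn _.
rewrite -(@flip_skeleton_box j (hemisphere j)) //; last 2 first.
- by rewrite /hemisphere leqnn andbT; case: ltnP.
- move=> l /andP[jl _]; have lj : (l <= j) = false by rewrite leqNgt jl.
  by rewrite /hemisphere lj andbF if_same.
have B_even := even_pinned_skeleton_box j.
rewrite chain_sum_flip //; apply: chain_sum_congr => // s _ s_box s_sorted.
rewrite /alternation; congr (_%:R)%R.
rewrite -[in RHS]alternates_swap; last exact: separated_labels (ltnW jn) s_box
  _.
congr (nat_of_bool (alternates _ (map _ _))); rewrite -!map_comp;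
  apply/eq_in_map => F Fs.
have BF := allP s_box F Fs.
have [_ F_nth] := in_boxP BF; rewrite size_skeleton_box in F_nth.
rewrite /= label_pair_hemisphere //.
- by apply: in_box_valid BF; rewrite ?size_skeleton_box.
- have /= := F_nth j jn'; rewrite nth_mkseq // ltnn => ->.
  by rewrite /extremal eqxx orbT.
- move=> jm; have /= := F_nth m mn; rewrite nth_mkseq // ltnNge (ltnW jm) /= =>
  ->.
  by rewrite /extremal eqxx orbT.
Qed.

Lemma deletions_alternation b s :
  deletions (alternation b) s = (alternation b s + alternation (~~ b) s)%R.
Proof.
rewrite /alternation.
rewrite (deletions_map label_pair
  (fun t => (alternates b (map signed_label t))%:R)%R).
rewrite (deletions_map signed_label (fun t => (alternates b t)%:R)%R).
rewrite (deletions_sort (fun t => (alternating b (map twisted_sign t))%:R)%R).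
rewrite (deletions_map twisted_sign (fun t => (alternating b t)%:R)%R).
exact: deletions_altern.
Qed.

Lemma chain_sumD beta beta' B : even_pinned N B ->
  chain_sum N (fun s => beta s + beta' s)%R B
  = (chain_sum N beta B + chain_sum N beta' B)%R.
Proof.
move=> B_even; rewrite /chain_sum -box_sumD; apply: eq_box_sum => // F _ _ _.
elim: (nfree B) F [::] => //= d IHd F acc; rewrite -big_split /=.
by apply: eq_bigr => G _; exact: IHd.
Qed.

Lemma label_pair_degenerate i j q F : valid_cell F -> i < j ->
  (j < m) || (m <= i) && (j < n.-1) -> extremal (nth 0 F i) -> q <= N.*2 ->
  label_pair (set_coord j q F) = label_pair F.
Proof.
move=> F_valid ij jm Fi qN; have jn1 : j < n.-1 by move: mn jm; lia.
have i_n : i < n by move: mn; lia.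
rewrite /label_pair -set_coord_flip; last by rewrite /= ltn_eqF.
by rewrite !(lab_degenerate _ ij) ?valid_flip ?extremal_flip.
Qed.

Lemma label_pair_flip_base i F : valid_cell F -> i < m ->
  extremal (nth 0 F i) ->
  label_pair (flip N (fun l => (l <= i) || (l == m)) F) = label_pair F.
Proof.
move=> F_valid im Fi; have i_n : i < n := ltn_trans im mn.
by rewrite /label_pair flip_comp !lab_flip_base ?valid_flip ?extremal_flip.
Qed.

(** Induction on dimension. By Fan's identity the two counts add up to the sum of a coboundary,
    hence to a sum over facets. All facets cancel except the smaller skeleton and its antipode,
    which give the two counts one dimension lower. A single vertex alternates with exactly one
    sign. *)
Lemma alternation_skeleton j : j <= n.-1 ->
  (chain_sum N (alternation true) (skeleton_box j)
   + chain_sum N (alternation false) (skeleton_box j) = 1)%R.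
Proof.
elim: j => [_|j IHj jn].
  rewrite -chain_sumD; last exact: even_pinned_skeleton_box.
  rewrite /chain_sum nfree_skeleton_box //.
  have box0 h : exists F, box_sum N (skeleton_box 0) h = h F.
    have -> : skeleton_box 0 = map Some (nseq n N.*2).
      by apply: (@eq_from_nth _ None);
        rewrite size_mkseq ?size_map ?size_nseq // => l ln;
        rewrite nth_mkseq // (nth_map 0) ?size_nseq // nth_nseq ln.
    elim: (n) h => [|n' IH] h /=; first by exists [::].
    by have [F ->] := IH (fun F => h (N.*2 :: F)); exists (N.*2 :: F).
  have [F ->] := box0 (flags (fun s => (alternation true s + alternation false
    s)%R) 0 ^~ [::]).
  rewrite /= /alternation /alternates /= /sort /=.
  by case: twisted_sign => /=; rewrite ?addr0 ?add0r.
have jn' : j < n by apply: leq_trans jn _; exact: leq_pred.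
rewrite -(IHj (ltnW jn)) -chain_sumD; last exact: even_pinned_skeleton_box.
transitivity (chain_sum N (deletions (alternation true)) (skeleton_box j.+1)).
  apply: chain_sum_congr => [|s _ _ _]; first exact: even_pinned_skeleton_box.
  by rewrite deletions_alternation.
rewrite skeleton_faces // big_ord_recr /= big1 ?add0r; last first.
  move=> i _; rewrite (face_cancel label_pair_degenerate label_pair_flip_base
    (fun t => (alternates true (map signed_label t))%:R)%R) //.
  by move=> j_eq; move: jn; rewrite j_eq ltnn.
rewrite skeleton_face_top // chain_sum_alternation_bottom //.
by rewrite addrC.
Qed.

(** Sperner's doors: a simplex with a door that misses the label [n] repeats some label [x < n], and
    its doors are exactly the two deletions of [x]. *)
Lemma deletions_perm_iota t : size t = n.+1 -> all (geq n) t ->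
  ~~ perm_eq t (iota 0 n.+1) ->
  deletions (fun u => (perm_eq u (iota 0 n))%:R : 'F_2)%R t = 0%R.
Proof.
move=> t_size t_le t_full; rewrite deletions_rem; last first.
  by move=> u v /permPl uv; rewrite uv.
have [/hasP[x xt x_perm]|/hasPn no_x] :=
    boolP (has (fun x => perm_eq (rem x t) (iota 0 n)) t); last first.
  by apply: big1_seq => x /andP[_ /no_x/negbTE->].
have t_perm : perm_eq t (x :: iota 0 n).
  by rewrite (permPl (perm_to_rem xt)) perm_cons.
have xn : x < n.
  have := allP t_le x xt; rewrite /= leq_eqVlt => /predU1P[x_eq|//].
  case/negP: t_full; rewrite (permPl t_perm) x_eq.
  by rewrite -[n.+1]addn1 iotaD -cat1s perm_catC.
have rem_eq y : y \in t -> perm_eq (rem y t) (iota 0 n) = (y == x).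
  move=> yt; apply/idP/eqP => [y_perm|-> //].
  have : perm_eq (y :: iota 0 n) (x :: iota 0 n).
    rewrite -(permPr t_perm) perm_sym (permPl (perm_to_rem yt)).
    by rewrite perm_cons.
  move=> /permP/(_ (pred1 x)) /=; rewrite eqxx.
  by case: eqP => //; lia.
transitivity (\sum_(y <- t) (y == x)%:R : 'F_2)%R.
  by apply: eq_big_seq => y yt; rewrite rem_eq.
rewrite (perm_big _ t_perm) big_cons /= eqxx (bigD1_seq x) ?iota_uniq //=;
  last first.
  by rewrite mem_iota.
by rewrite eqxx big1 ?addr0 ?addrr_F2 // => y /negbTE->.
Qed.

Lemma perm_lab_alternation s : all (in_box N (skeleton_box n.-1)) s ->
  sorted face s -> size s = n ->
  ((perm_eq (map lab s) (iota 0 n))%:R = alternation true s)%R /\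
  ((perm_eq (map lab (map antipode s)) (iota 0 n))%:R = alternation false s)%R.
Proof.
move=> s_box s_sorted s_size.
have s_sep := separated_labels (leqnn _) s_box s_sorted.
have s_valid F : F \in s -> valid_cell F.
  move=> /(allP s_box); apply: in_box_valid; rewrite ?size_skeleton_box //.
  exact: even_pinned_skeleton_box.
have pair_le : all (fun x => (x.1 <= n) && (x.2 <= n)) (map label_pair s).
  rewrite all_map; apply/allP => F Fs /=.
  by rewrite !lab_le ?valid_flip ?s_valid.
split; rewrite /alternation; congr (nat_of_bool _)%:R%R.
  by rewrite -(perm_iota_alternates s_sep _ pair_le) ?size_map // -map_comp.
rewrite -[RHS](@alternates_swap true) // -(@perm_iota_alternates n) ?size_map
  //.
- by rewrite -!map_comp.
- by move=> _ _ /mapP[x xs ->] /mapP[y ys ->]; rewrite eq_sym; exact: s_sep.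
- by rewrite all_map; apply: sub_all pair_le => x /=; rewrite andbC.
Qed.

(** Without a fully labelled simplex each simplex has an even number of doors, so the total over the
    cube is 0. By Stokes it equals the number of doors on the two radial facets, which by
    [perm_lab_alternation] is the count of alternating simplices of both signs, an odd number. *)
Theorem full_flag : exists s, [/\ sorted face s, all valid_cell s,
  size s = n.+1 & perm_eq (map lab s) (iota 0 n.+1)].
Proof.
apply: contrapT => no_full.
pose gamma (s : seq cell) : 'F_2 := (perm_eq (map lab s) (iota 0 n))%:R%R.
have last_eq : n.-1.+1 = n := prednK n_gt0.
have full_even := even_pinned_skeleton_box n.
have gamma_full : chain_sum N (deletions gamma) (skeleton_box n) = 0%R.
  rewrite (@chain_sum_congr N _ (fun s => gamma s + gamma s)%R) //.
    by rewrite chain_sumD ?addrr_F2.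
  rewrite nfree_skeleton_box // => s s_size s_box s_sorted; rewrite addrr_F2.
  have s_valid : all valid_cell s.
    by apply: sub_all s_box => F; apply: in_box_valid;
      rewrite ?size_skeleton_box.
  rewrite (deletions_map lab (fun t => (perm_eq t (iota 0 n))%:R)%R).
  apply: deletions_perm_iota; first by rewrite size_map.
    by rewrite all_map; apply: sub_all s_valid => F /= /lab_le.
  by apply: contra_notN no_full => s_full; exists s.
have : chain_sum N (deletions gamma) (skeleton_box n.-1.+1) = 1%R.
  rewrite skeleton_faces // big_ord_recr /= big1 ?add0r; last first.
    move=> i _; rewrite (face_cancel lab_degenerate lab_flip_base
      (fun t => (perm_eq t (iota 0 n))%:R)%R) //.
    (* Reversing the fibre direction and the radius together fixes the point: apply [lab_flip_fibre]
       to the antipode of [F]. *)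
    move=> _ F F_valid F_ext mn2.
    have n2 : n.-2 < n.-1 by have := ltn_ord i; lia.
    have n2' : n.-2 < n by lia.
    have := lab_flip_fibre (valid_flip (pred1 n.-1) F_valid) (i := n.-2).
    rewrite mn2 n2 => /(_ isT (extremal_flip _ F_valid n2' F_ext)).
    rewrite flipK // => <-; congr lab; have /andP[/eqP F_size F_le] := F_valid.
    rewrite /flip coordwise_coordwise; apply: eq_coordwise => l.
    rewrite F_size => ln /=; case: (eqVneq l n.-1) => [->|l_neq].
      by rewrite (leqNgt n.-1) n2 andbF -ltnS last_eq mn.
    by rewrite (_ : l <= n.-2) ?andbT //; lia.
  rewrite skeleton_face_top // -(@flip_skeleton_box n.-1 (pred1 n.-1)) //=;
    last first.
    by move=> l; lia.
  have B_even := even_pinned_skeleton_box n.-1.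
  rewrite chain_sum_flip // -(alternation_skeleton (leqnn _)) addrC.
  congr (_ + _)%R; apply: chain_sum_congr => // s;
    rewrite nfree_skeleton_box ?leq_pred // last_eq => s_size s_box s_sorted;
    by have [] := perm_lab_alternation s_box s_sorted s_size.
by rewrite last_eq gamma_full.
Qed.

End Labelling.
End Cube.
End Parity.

(** * The topology of the Grassmannian *)

Section Frames.
Variables (R : realType) (n k : nat).
Local Notation G := (grassmannian R n k).
Local Notation frames := (@frames R n k).
Implicit Types (A B : 'M[R]_(k, n)) (x : 'rV[R]_n) (L : G).

Lemma mulmx_trmx_eq0 x : x *m x^T = 0 -> x = 0.
Proof.
move=> /(congr1 (fun M : 'M[R]_1 => M 0 0)); rewrite !mxE => /eqP.
under eq_bigr => j _ do rewrite mxE -expr2.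
rewrite psumr_eq0 => [/allP x0|j _]; last exact: sqr_ge0.
apply/rowP => i; rewrite mxE; apply/eqP.
by have := x0 i (mem_index_enum _); rewrite /= sqrf_eq0.
Qed.

Lemma row_free_gram p (A : 'M[R]_(p, n)) :
  row_free A = (\det (A *m A^T) != 0).
Proof.
apply/idP/idP => [A_free|].
  rewrite -unitfE -unitmxE -row_free_unit; apply: inj_row_free => v vA.
  apply/eqP; rewrite -(mulmx_free_eq0 _ A_free); apply/eqP/mulmx_trmx_eq0.
  by rewrite trmx_mul mulmxA -(mulmxA v) vA mul0mx.
rewrite -unitfE -unitmxE => A_unit; apply/row_freeP.
by exists (A^T *m invmx (A *m A^T)); rewrite mulmxA mulmxV.
Qed.

Definition frame_tuple A : k.-tuple 'rV[R]_n :=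
  map_tuple (fun i => row i A) (ord_tuple k).

Lemma frame_tuple_nth A (i : 'I_k) : (frame_tuple A)`_i = row i A.
Proof. by rewrite -tnth_nth tnth_map tnth_ord_tuple. Qed.

Lemma frame_comb A (c : 'I_k -> R) :
  \sum_(i < k) c i *: (frame_tuple A)`_i = (\row_i c i) *m A.
Proof.
by rewrite mulmx_sum_row; apply: eq_bigr => i _; rewrite mxE frame_tuple_nth.
Qed.

Lemma framesE A : frames A <-> row_free A.
Proof.
split=> [A_frame|A_free].
  have /freeP A_free : free (frame_tuple A) := A_frame.
  apply: inj_row_free => v vA; apply/rowP => i; rewrite mxE.
  apply: (A_free (fun i => v 0 i)); rewrite frame_comb -[RHS]vA; congr (_ *m A).
  by apply/rowP => j; rewrite mxE.
rewrite /Defs.frames /= -[frame_seq A]/(tval (frame_tuple A)).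
apply/freeP => c; rewrite frame_comb => /eqP.
by rewrite mulmx_free_eq0 // => /eqP/rowP c0 i; have := c0 i; rewrite !mxE.
Qed.

Lemma mem_frame_span A x :
  (x \in <<frame_seq A>>%VS) <-> exists y : 'rV_k, x = y *m A.
Proof.
rewrite -[frame_seq A]/(tval (frame_tuple A));
  split=> [/coord_span x_eq|[y ->]].
  by exists (\row_i coord (frame_tuple A) i x); rewrite -frame_comb.
rewrite mulmx_sum_row; apply: memv_suml => i _; apply: memvZ.
by apply: memv_span; rewrite -frame_tuple_nth mem_nth // size_tuple.
Qed.

Definition mk_frame A (A_free : row_free A) : frames :=
  exist _ A (mem_set ((framesE A).2 A_free)).

Lemma frame_surj L : exists A (A_free : row_free A), L = frame_span (mk_frame
  A_free).
Proof.
case: L => U dimU; pose A : 'M[R]_(k, n) := \matrix_(i < k) (vbasis U)`_i.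
have A_seq : frame_seq A = vbasis U :> seq _.
  have b_size : size (vbasis U) = k by rewrite size_tuple (eqP dimU).
  apply: (@eq_from_nth _ 0); first by rewrite size_map size_enum_ord.
  rewrite size_map size_enum_ord => i ik.
  by have := frame_tuple_nth A (Ordinal ik); rewrite rowK.
have A_frame : frames A.
  by rewrite /Defs.frames /= A_seq; exact: basis_free (vbasisP U).
exists A, ((framesE A).1 A_frame); apply: val_inj.
by rewrite /= A_seq (span_basis (vbasisP U)).
Qed.

Lemma frame_span_eq (A B : frames) : frame_span A = frame_span B ->
  exists2 g : 'M[R]_k, g \in unitmx & val B = g *m val A.
Proof.
move=> eqAB.
have eq_span : <<frame_seq (val A)>>%VS = <<frame_seq (val B)>>%VS.
  by have := congr1 (@subspace_of _ _ _) eqAB.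
have /choice[g g_row] : forall i, exists y : 'rV_k, row i (val B) = y *m val A.
  move=> i; apply/mem_frame_span; rewrite eq_span; apply/mem_frame_span.
  by exists (delta_mx 0 i); rewrite rowE.
have B_eq : val B = (\matrix_i g i) *m val A.
  by apply/row_matrixP => i; rewrite row_mul rowK.
exists (\matrix_i g i) => //; rewrite -row_free_unit.
have /framesE B_free : frames (val B) := set_mem (valP B).
rewrite -kermx_eq0; apply/eqP/row_matrixP => i; rewrite row0.
apply/eqP; rewrite -(mulmx_free_eq0 _ B_free) B_eq mulmxA -row_mul mulmx_ker.
by rewrite row0 mul0mx.
Qed.

Lemma cvg_det (T : Type) (F : set_system T) (FF : Filter F) q
    (M : T -> 'M[R]_q) (M0 : 'M[R]_q) :
  (forall i j, M t i j @[t --> F] --> M0 i j) ->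
  \det (M t) @[t --> F] --> \det M0.
Proof.
move=> MM0; rewrite /determinant.
apply: (cvg_big (op := +%R)) => [|s _]; first exact: add_continuous.
apply: cvgM; first exact: cvg_cst.
apply: (@cvg_big R _ (@GRing.mul R) 1 predT (@mul_continuous R) T F _
  (fun i t => M t i (perm.fun_of_perm s i)) (fun i =>
    M0 i (perm.fun_of_perm s i)) FF) => i _.
exact: MM0.
Qed.

Lemma cvg_mulmx (T : Type) (F : set_system T) (FF : Filter F) p q r
    (M : T -> 'M[R]_(p, q)) (N : T -> 'M[R]_(q, r)) (M0 : 'M[R]_(p, q))
    (N0 : 'M[R]_(q, r)) :
  (forall i j, M t i j @[t --> F] --> M0 i j) ->
  (forall i j, N t i j @[t --> F] --> N0 i j) ->
  forall i j, (M t *m N t) i j @[t --> F] --> (M0 *m N0) i j.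
Proof.
move=> MM0 NN0 i j; rewrite mxE; under eq_fun => t do rewrite mxE.
apply: (cvg_big (op := +%R)) => [|l _]; first exact: add_continuous.
by apply: cvgM; [exact: MM0 | exact: NN0].
Qed.

(* Up to the nonzero factor [gram A], the Gram determinant of [A] extended by
   the row [x] is the squared distance from [x] to the span of [A]. *)
Definition gram p (A : 'M[R]_(p, n)) : R := \det (A *m A^T).

Lemma cvg_gram (T : Type) (F : set_system T) (FF : Filter F) p
    (A : T -> 'M[R]_(p, n)) (A0 : 'M[R]_(p, n)) :
  (forall i j, A t i j @[t --> F] --> A0 i j) ->
  gram (A t) @[t --> F] --> gram A0.
Proof.
move=> AA0; apply: cvg_det => i j; apply: cvg_mulmx => // l c.
by rewrite mxE; under eq_fun => t do rewrite mxE; exact: AA0.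
Qed.

Lemma gram_mul p (g : 'M[R]_p) (A : 'M[R]_(p, n)) :
  gram (g *m A) = \det g ^+ 2 * gram A.
Proof.
by rewrite /gram trmx_mul mulmxA -(mulmxA g) !det_mulmx det_tr expr2 mulrAC.
Qed.

Lemma gram_col_mul (g : 'M[R]_k) A x :
  gram (col_mx (g *m A) x) = \det g ^+ 2 * gram (col_mx A x).
Proof.
have -> : col_mx (g *m A) x = block_mx g 0 0 1%:M *m col_mx A x.
  by rewrite mul_block_col !mul0mx mul1mx addr0 add0r.
by rewrite gram_mul det_ublock det1 mulr1.
Qed.

Lemma gram_col_eq0 A x : row_free A ->
  (gram (col_mx A x) == 0) <-> (exists y : 'rV_k, x = y *m A).
Proof.
move=> A_free; split => [|[y ->]].
  rewrite -[_ == 0]negbK -row_free_gram => /negP nfree.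
  apply: contrapT => no_y; apply: nfree; apply: inj_row_free => v.
  rewrite -[v]hsubmxK mul_row_col => vA.
  have v0 : rsubmx v = 0.
    apply/eqP/negPn/negP => v_neq; apply: no_y.
    have rE : rsubmx v = (rsubmx v 0 0)%:M by rewrite -mx11_scalar.
    have r0 : rsubmx v 0 0 != 0 by apply: contraNneq v_neq => r0;
      rewrite rE r0 raddf0.
    exists (- (rsubmx v 0 0)^-1 *: lsubmx v); rewrite -scalemxAl.
    move/eqP: vA; rewrite addr_eq0 => /eqP ->.
    by rewrite rE mul_scalar_mx -rE scaleNr scalerN opprK scalerA mulVf //
      scale1r.
  move: vA; rewrite v0 mul0mx addr0 => /eqP;
    rewrite mulmx_free_eq0 // => /eqP ->.
  by rewrite row_mx0.
rewrite -[_ == 0]negbK -row_free_gram; apply/negP => /row_freeP[B].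
move=> /(congr1 (mulmx (row_mx y (- 1%:M)))).
rewrite mulmxA mul_row_col mulNmx mul1mx subrr mul0mx mulmx1 => /esym/eqP.
rewrite row_mx_eq0 oppr_eq0 => /andP[_].
by move=> /eqP/(congr1 (fun M : 'M[R]_1 => M 0 0)); rewrite !mxE eqxx => /eqP;
  rewrite oner_eq0.
Qed.

(** Its sign compares the fourth power of the distance from [x] to the span of [A] with [c]. It does
    not depend on the frame, since both terms scale by the fourth power of the determinant; the
    squares make both factors of [c] and 1 visibly nonnegative. *)
Definition gram_gap c x (A : 'M[R]_(k, n)) : R :=
  gram (col_mx A x) ^+ 2 - c * gram A ^+ 2.

Lemma cvg_gram_gap c x (T : Type) (F : set_system T) (FF : Filter F)
    (A : T -> 'M[R]_(k, n)) (A0 : 'M[R]_(k, n)) :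
  (forall i j, A t i j @[t --> F] --> A0 i j) ->
  gram_gap c x (A t) @[t --> F] --> gram_gap c x A0.
Proof.
move=> AA0; have col_cvg i j : col_mx (A t) x i j @[t --> F] --> col_mx A0 x i
  j.
  rewrite !mxE; under eq_fun => t do rewrite !mxE.
  by case: (fintype.split i) => l; [exact: AA0 | exact: cvg_cst].
rewrite /gram_gap; under eq_fun => t do rewrite !expr2.
rewrite !expr2; apply: cvgB; first by apply: cvgM; exact: cvg_gram.
by apply: cvgM; [exact: cvg_cst | apply: cvgM; exact: cvg_gram].
Qed.

Definition grass_open (e : R) c x : set G :=
  [set L | exists2 B : frames, L = frame_span B & 0 < e * gram_gap c x (val B)].

Lemma grass_openE e c x (A : frames) :
  grass_open e c x (frame_span A) <-> 0 < e * gram_gap c x (val A).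
Proof.
split=> [[B /frame_span_eq[g g_unit ->]]|]; last by exists A.
have -> : gram_gap c x (g *m val A) = \det g ^+ 4 * gram_gap c x (val A).
  by rewrite /gram_gap gram_col_mul gram_mul; ring.
rewrite mulrCA pmulr_rgt0 // exprn_even_gt0 //=.
by rewrite -unitfE -unitmxE.
Qed.

Lemma open_grass_open e c x : open (grass_open e c x).
Proof.
have : open [set B : 'M[R]_(k, n) | 0 < e * gram_gap c x B].
  have /continuousP : continuous (fun B : 'M[R]_(k, n) => e * gram_gap c x B).
    move=> B; apply: (@cvgM _ _ (nbhs B) _ (cst e) (gram_gap c x)).
      exact: cvg_cst.
    by apply: (@cvg_gram_gap c x _ (nbhs B) _ id B) => i j;
      exact: coord_continuous.
  by move=> /(_ [set r | 0 < r] (@open_gt _ 0)).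
move=> oU; exists [set B : 'M[R]_(k, n) | 0 < e * gram_gap c x B] => //.
by apply/seteqP; split => A; rewrite /preimage /= => /grass_openE.
Qed.

(** Serves to make the compact sets [V i] closed. A vector of L1 outside L2 separates the two planes
    by its distance to them. *)
Lemma grassmannian_hausdorff : hausdorff_space G.
Proof.
rewrite open_hausdorff => L1 L2 L12.
have [A [A_free L1E]] := frame_surj L1; have [B [B_free L2E]] := frame_surj L2.
have [x xA xB] : exists2 x, x \in subspace_of L1 & x \notin subspace_of L2.
  apply: contrapT => no_x; case/eqP: L12; apply: val_inj; apply/eqP.
  rewrite eqEdim; apply/andP; split.
    by apply/subvP => x xL1; apply: contrapT => /negP xL2; apply: no_x;
      exists x.
  by case: (L1) => U1 /= /eqP->; case: (L2) => U2 /= /eqP->.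
have gA : gram (col_mx A x) = 0.
  by apply/eqP/(gram_col_eq0 _ A_free)/mem_frame_span; rewrite L1E in xA.
have gB : gram (col_mx B x) != 0.
  apply: contra xB => /(gram_col_eq0 _ B_free)/mem_frame_span.
  by rewrite L2E.
have nA : gram A != 0 by rewrite -row_free_gram.
have nB : gram B != 0 by rewrite -row_free_gram.
(* Half the ratio of squared Gram determinants at L2; the ratio at L1 is 0. *)
pose c := gram (col_mx B x) ^+ 2 / (2 * gram B ^+ 2).
have sq0 (r : R) : r != 0 -> 0 < r ^+ 2 by move=> r0; rewrite exprn_even_gt0.
have c0 : 0 < c.
  apply: divr_gt0; first exact: sq0.
  by apply: mulr_gt0; [rewrite ltr0n | exact: sq0].
exists (grass_open (-1) c x, grass_open 1 c x) => /=.
  rewrite !inE L1E L2E; split; apply/grass_openE => /=.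
    rewrite /gram_gap gA expr0n /= sub0r mulN1r opprK.
    by apply: mulr_gt0; last exact: sq0.
  rewrite mul1r /gram_gap subr_gt0 /c.
  have -> : gram (col_mx B x) ^+ 2 / (2 * gram B ^+ 2) * gram B ^+ 2
    = gram (col_mx B x) ^+ 2 / 2 by field.
  by have := sq0 _ gB; lra.
split; [exact: open_grass_open | exact: open_grass_open |].
apply/eqP/seteqP; split => // L [] /=.
have [C [C_free ->]] := frame_surj L.
move=> /grass_openE gap1 /grass_openE gap2; exfalso.
by move: gap1 gap2; rewrite mulN1r mul1r oppr_gt0; lra.
Qed.

End Frames.

(** * Limits along ultrafilters, in place of successive subsequences *)

Lemma ultra_cvg_bounded (R : realType) (T : Type) (F : set_system T)
    (UF : UltraFilter F) (u : T -> R) (M : R) :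
  (forall t, `|u t| <= M) -> exists2 l : R, u @ F --> l & `|l| <= M.
Proof.
move=> uM.
have inM t : `[- M, M]%classic (u t) by rewrite /= in_itv /= -ler_norml.
have [l [lM l_cluster]] : `[- M, M]%classic `&` cluster (u @ F) !=set0.
  apply: segment_compact.
  by apply: (@filterS _ F _ setT) => [t _|]; [exact: inM | exact: filterT].
exists l; last by move: lM; rewrite /= in_itv /= -ler_norml.
move=> A lA; have [//|FA] := in_ultra_setVsetC (u @^-1` A) UF.
have [r [rA rnA]] := l_cluster (~` A) A FA lA.
by [].
Qed.

Lemma hausdorff_space_prod (T U : topologicalType) :
  hausdorff_space T -> hausdorff_space U -> hausdorff_space (T * U)%type.
Proof.
move=> hT hU [p1 p2] [q1 q2] pq; congr pair.
  apply: hT => A B pA qB.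
  have [||[r1 r2] [[/= rA _] [rB _]]] := pq (A `*` setT) (B `*` setT).
  - by exists (A, setT) => //; split => //; exact: filterT.
  - by exists (B, setT) => //; split => //; exact: filterT.
  by exists r1.
apply: hU => A B pA qB.
have [||[r1 r2] [[/= _ rA] [_ rB]]] := pq (setT `*` A) (setT `*` B).
- by exists (setT, A) => //; split => //; exact: filterT.
- by exists (setT, B) => //; split => //; exact: filterT.
by exists r2.
Qed.

Lemma cvg_mx_entries (R : realType) (T : Type) (F : set_system T)
    (FF : Filter F) p q (A : T -> 'M[R]_(p, q)) (A0 : 'M[R]_(p, q)) :
  (forall i j, A t i j @[t --> F] --> A0 i j) -> A @ F --> A0.
Proof.
move=> AA0; apply/cvg_ballP => e e0.
have : \forall t \near F, forall i j, ball (A0 i j) e (A t i j).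
  apply: filter_forall => i; apply: filter_forall => j.
  exact: (cvg_ballP _ _).1 (AA0 i j) e e0.
by apply: filterS => t At; split.
Qed.

Lemma cvg_frame_span (R : realType) n k (T : Type) (F : set_system T)
    (FF : Filter F) (A : T -> @frames R n k) (A0 : @frames R n k) :
  (forall i j, val (A t) i j @[t --> F] --> val A0 i j) ->
  frame_span (A t) @[t --> F] --> frame_span A0.
Proof.
move=> AA0 U; rewrite nbhsE => -[W [oW WA0] WU].
have /= [Z openZ ZW] := oW.
have WZ (B : @frames R n k) : W (frame_span B) = Z (val B).
  by rewrite -[RHS]/((set_val @^-1` Z) B) ZW.
have : \forall t \near F, Z (val (A t)).
  by apply: (cvg_mx_entries FF AA0); apply: open_nbhs_nbhs; split => //;
    rewrite -WZ.
by apply: filterS => t At; apply: WU; rewrite WZ.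
Qed.

(** * Euclidean geometry and the Hausdorff distance *)

Section Dot.
Variables (R : realType) (n : nat).
Implicit Types x y z : 'rV[R]_n.

Lemma cvg_dotv (T : Type) (F : set_system T) (FF : Filter F)
    (x y : T -> 'rV[R]_n) (x0 y0 : 'rV[R]_n) :
  (forall c, x t 0 c @[t --> F] --> x0 0 c) ->
  (forall c, y t 0 c @[t --> F] --> y0 0 c) ->
  dotv (x t) (y t) @[t --> F] --> dotv x0 y0.
Proof.
move=> xx0 yy0; rewrite /dotv.
apply: (@cvg_big R _ +%R 0 predT (@add_continuous R) T F _
  (fun i t => x t 0 i * y t 0 i) (fun i => x0 0 i * y0 0 i) FF) => i _.
by apply: cvgM; [exact: xx0 | exact: yy0].
Qed.

Lemma dotvC x y : dotv x y = dotv y x.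
Proof. by apply: eq_bigr => i _; rewrite mulrC. Qed.

Lemma dotvDl x y z : dotv (x + y) z = dotv x z + dotv y z.
Proof. by rewrite /dotv -big_split; apply: eq_bigr => i _;
  rewrite mxE mulrDl. Qed.

Lemma dotvZl a x y : dotv (a *: x) y = a * dotv x y.
Proof. by rewrite /dotv mulr_sumr; apply: eq_bigr => i _;
  rewrite mxE mulrA. Qed.

Lemma dotvDr x y z : dotv x (y + z) = dotv x y + dotv x z.
Proof. by rewrite dotvC dotvDl !(dotvC _ x). Qed.

Lemma dotvZr a x y : dotv x (a *: y) = a * dotv x y.
Proof. by rewrite dotvC dotvZl dotvC. Qed.

Lemma dotvNl x y : dotv (- x) y = - dotv x y.
Proof. by rewrite -scaleN1r dotvZl mulN1r. Qed.

Lemma dotvNr x y : dotv x (- y) = - dotv x y.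
Proof. by rewrite dotvC dotvNl dotvC. Qed.

Definition dotvE := (dotvDl, dotvDr, dotvZl, dotvZr, dotvNl, dotvNr).

Lemma dotvv_ge0 x : 0 <= dotv x x.
Proof. by apply: sumr_ge0 => i _; rewrite -expr2 sqr_ge0. Qed.

Lemma dotvv_eq0 x : (dotv x x == 0) = (x == 0).
Proof.
apply/idP/eqP => [|->]; last by rewrite /dotv big1 // => i _; rewrite mxE mul0r.
rewrite psumr_eq0 => [/allP x0|i _]; last by rewrite -expr2 sqr_ge0.
apply/rowP => i; rewrite mxE; apply/eqP.
by have := x0 i (mem_index_enum _); rewrite /= mulf_eq0 orbb.
Qed.

Lemma dotvv_gt0 x : (0 < dotv x x) = (x != 0).
Proof. by rewrite lt_neqAle dotvv_ge0 andbT eq_sym dotvv_eq0. Qed.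

Lemma sqr_coord_le x c : x 0 c ^+ 2 <= dotv x x.
Proof.
rewrite /dotv (bigD1 c) //= -expr2 lerDl.
by apply: sumr_ge0 => i _; rewrite -expr2 sqr_ge0.
Qed.

Lemma coord_le_eucl_dist x y c : `|x 0 c - y 0 c| <= eucl_dist x y.
Proof.
rewrite /eucl_dist -sqrtr_sqr ler_wsqrtr //.
by have := sqr_coord_le (x - y) c; rewrite !mxE.
Qed.

Lemma eucl_dist_ge0 x y : 0 <= eucl_dist x y.
Proof. exact: sqrtr_ge0. Qed.

Lemma eucl_dist_bounded x y M : (forall c, `|x 0 c - y 0 c| <= M) -> 0 <= M ->
  eucl_dist x y <= Num.sqrt (n%:R * M ^+ 2).
Proof.
move=> xyM M0; rewrite /eucl_dist ler_wsqrtr // /dotv.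
rewrite mulr_natl -[X in M ^+ 2 *+ X](card_ord n) -sumr_const;
  apply: ler_sum => i _.
rewrite -expr2 !mxE -real_normK ?num_real //.
by rewrite ler_sqr ?nnegrE ?normr_ge0.
Qed.

Lemma le_dist_to_set x y (K : set 'rV[R]_n) : K y ->
  dist_to_set x K <= eucl_dist x y.
Proof.
move=> Ky; apply: ge_inf; last by exists y.
by exists 0 => _ [z _ <-]; exact: eucl_dist_ge0.
Qed.

Lemma dist_to_set_lt x (K : set 'rV[R]_n) e : K !=set0 -> dist_to_set x K < e ->
  exists2 y, K y & eucl_dist x y < e.
Proof.
move=> [y Ky] /inf_lt[]; first by exists (eucl_dist x y), y.
by move=> _ [z Kz <-] ze; exists z.
Qed.

(** The common bound [M] ensures that the supremum in the Hausdorff distance is taken over a bounded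
    set, hence is a genuine upper bound. *)
Lemma dist_to_set_le_hausdorff (K1 K2 : set 'rV[R]_n) M z :
  K1 !=set0 -> 0 <= M -> (forall x c, K1 x -> `|x 0 c| <= M) ->
  (forall x c, K2 x -> `|x 0 c| <= M) -> K2 z ->
  dist_to_set z K1 <= hausdorff_dist K1 K2.
Proof.
move=> [y1 K1y1] M0 K1M K2M K2z; rewrite /hausdorff_dist le_max; apply/orP;
  right.
apply: ub_le_sup; last by exists z.
exists (Num.sqrt (n%:R * (M + M) ^+ 2)) => _ [x K2x <-].
apply: le_trans (le_dist_to_set x K1y1) _; apply: eucl_dist_bounded.
  move=> c; apply: le_trans (ler_normB _ _) _.
  by apply: lerD; [exact: K2M | exact: K1M].
by rewrite addr_ge0.
Qed.

End Dot.
(** * Nearest points in the fibres *)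

Section Bundle.
Variables (R : realType) (n k : nat).
Local Notation G := (grassmannian R n k).
Variable V : 'I_n.+1 -> set (G * 'rV[R]_n).
Hypothesis V_bundle : forall i, V i `<=` @canonical_bundle R n k.
Hypothesis V_compact : forall i, compact (V i).
Hypothesis V_nonempty : forall i L, fiber (V i) L !=set0.
Hypothesis V_continuous : forall i (L0 : G),
  hausdorff_dist (fiber (V i) L) (fiber (V i) L0) @[L --> L0] --> (0 : R).
Hypothesis V_convex : forall L : G,
  @convex_set R 'rV[R]_n (fiber (\bigcup_i V i) L).
Implicit Types (L : G) (x p z : 'rV[R]_n).

Definition union_fiber L : set 'rV[R]_n := fiber (\bigcup_i V i) L.

Lemma V_bounded : exists2 M : R, 0 <= M &
  forall i L x c, V i (L, x) -> `|x 0 c| <= M.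
Proof.
have /choice[f fP] : forall ic : 'I_n.+1 * 'I_n, exists M : R,
    forall L x, V ic.1 (L, x) -> `|x 0 ic.2| <= M.
  move=> [i c]; pose h (q : G * 'rV[R]_n) := q.2 0 c.
  have h_cont : continuous h.
    move=> q; apply: (@continuous_comp _ _ _ snd (fun x : 'rV[R]_n => x 0 c)).
      exact: cvg_snd.
    exact: coord_continuous.
  have /compact_bounded[M [_ hM]] : compact (h @` V i).
    by apply: continuous_compact => //; exact: continuous_subspaceT.
  exists (M + 1) => L x Vx; apply: (hM (M + 1)); first by rewrite ltrDl.
  by exists (L, x).
exists (\sum_ic `|f ic|); first by apply: sumr_ge0 => ic _; exact: normr_ge0.
move=> i L x c Vx; apply: le_trans (fP (i, c) L x Vx) _.
apply: le_trans (ler_norm _) _; rewrite (bigD1 (i, c)) //= lerDl.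
by apply: sumr_ge0 => ic _; exact: normr_ge0.
Qed.

Lemma V_closed i : closed (V i).
Proof.
apply: compact_closed; last exact: V_compact.
by apply: hausdorff_space_prod; [exact: grassmannian_hausdorff | exact:
  norm_hausdorff].
Qed.

Lemma closed_lim (W : set (G * 'rV[R]_n)) (T : Type) (F : set_system T)
    (FF : ProperFilter F) (L : T -> G) (x : T -> 'rV[R]_n) L0 x0 :
  closed W -> L @ F --> L0 -> (forall c, x t 0 c @[t --> F] --> x0 0 c) ->
  (forall t, W (L t, x t)) -> W (L0, x0).
Proof.
move=> W_closed LL0 xx0 Wx.
apply: (@closed_cvg _ _ F FF (fun t => (L t, x t)) W W_closed) => //.
  by apply: filterE.
have xF : x @ F --> x0 by apply: cvg_mx_entries => i c; rewrite (ord1 i);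
  exact: xx0.
exact: (cvg_pair LL0 xF).
Qed.

Lemma V_lower (F : set_system nat) (UF : UltraFilter F) (L : nat -> G) L0 i z :
  \oo `<=` F -> L @ F --> L0 -> fiber (V i) L0 z ->
  exists2 y : nat -> 'rV[R]_n, forall t, V i (L t, y t) &
    forall c, y t 0 c @[t --> F] --> z 0 c.
Proof.
move=> ooF LL0 Vz; have [M M0 VM] := V_bounded.
have near_z t : exists y, V i (L t, y) /\
    eucl_dist z y < dist_to_set z (fiber (V i) (L t)) + t.+1%:R^-1.
  have [|y Vy zy] := @dist_to_set_lt _ _ z (fiber (V i) (L t))
    (dist_to_set z (fiber (V i) (L t)) + t.+1%:R^-1) (V_nonempty i (L t)).
    by rewrite ltrDl invr_gt0 ltr0n.
  by exists y.
have {near_z}[y yP] := choice near_z.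
exists y => [t|c]; first by have [] := yP t.
pose e t := hausdorff_dist (fiber (V i) (L t)) (fiber (V i) L0) + t.+1%:R^-1.
have e0 : e @ F --> (0 : R).
  rewrite -[0 in X in _ --> X]addr0; apply: cvgD.
    exact: (@cvg_comp _ _ _ L (fun L' => hausdorff_dist (fiber (V i) L')
      (fiber (V i) L0)) F (nbhs L0) (nbhs (0:R)) LL0 (V_continuous i L0)).
  by apply: cvg_trans (@cvg_harmonic R); apply: cvg_app.
have ye t : `|y t 0 c - z 0 c| <= e t.
  rewrite distrC; apply: le_trans (coord_le_eucl_dist z (y t) c) _.
  have [_ /ltW/le_trans->//] := yP t; rewrite lerD2r.
  apply: (@dist_to_set_le_hausdorff _ _ _ _ M) => //.
    by move=> x c'; exact: VM.
  by move=> x c'; exact: VM.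
rewrite -[z 0 c]addr0; under eq_fun => t do rewrite -[y t 0 c](addrNK (z 0 c))
  addrC.
apply: cvgD; first exact: cvg_cst.
apply/norm_cvg0P; apply: (@squeeze_cvgr _ _ _ _ (cst 0) e) => //.
  by apply: filterE => t; rewrite normr_ge0 ye.
exact: cvg_cst.
Qed.

Definition is_proj L x p :=
  union_fiber L p /\
  forall z, union_fiber L z -> dotv (x - p) (x - p) <= dotv (x - z) (x - z).

Lemma union_fiber_conv L x z (a : R) : union_fiber L x -> union_fiber L z ->
  0 <= a <= 1 -> union_fiber L (a *: x + (1 - a) *: z).
Proof.
move=> Kx Kz a01.
have := @V_convex L x z (Itv01 (andP a01).1 (andP a01).2).
rewrite !inE => /(_ Kx Kz).
by rewrite /conv /=.
Qed.

Lemma union_fiber_closed : closed (\bigcup_i V i).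
Proof.
by apply: closed_bigcup => [|i _]; [exact: finite_finset | exact: V_closed].
Qed.

Lemma is_proj_exists L x : exists p, is_proj L x p.
Proof.
have [M M0 VM] := V_bounded.
have K_compact : compact (union_fiber L).
  apply: bounded_closed_compact.
    exists M; split; first exact: num_real.
    move=> M' /ltW MM' y [i _ Vy]; rewrite /Num.norm /= mx_normrE.
    apply: bigmax_le => [|[i' c] _]; first exact: le_trans MM'.
    by rewrite (ord1 i'); apply: le_trans MM'; exact: VM Vy.
  apply: (@preimage_closed _ _ (fun y => (L, y))) union_fiber_closed => y _.
  have L_cvg : cst L @ nbhs y --> L by exact: cvg_cst.
  exact: (cvg_pair L_cvg (@cvg_id _ (nbhs y))).
have K_nonempty : union_fiber L !=set0.
  by have [y Vy] := V_nonempty ord0 L; exists y, ord0.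
have [|p Kp p_min] := @EVT_min_rV R n (fun y =>
  dotv (x - y) (x - y)) _ K_nonempty K_compact.
  apply: continuous_subspaceT => y.
  apply: (@cvg_dotv R n _ (nbhs y)) => c; rewrite !mxE;
    under eq_fun => t do rewrite !mxE;
    by apply: cvgB; [exact: cvg_cst | exact: coord_continuous].
exists p; split; first by move: Kp; rewrite inE.
by move=> z Kz; apply: p_min; rewrite inE.
Qed.

(** The midpoint of two distinct nearest points would be nearer still. *)
Lemma is_proj_uniq L x p q : is_proj L x p -> is_proj L x q -> p = q.
Proof.
move=> [Kp p_min] [Kq q_min].
have Kw : union_fiber L (2^-1 *: p + (1 - 2^-1) *: q).
  by apply: union_fiber_conv => //; lra.
have := p_min _ Kw; have := q_min _ Kw.
have -> : x - (2^-1 *: p + (1 - 2^-1) *: q)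
    = 2^-1 *: (x - p) + 2^-1 *: ((x - p) + (p - q)).
  by apply/rowP => c; rewrite !mxE; field.
have -> : x - q = (x - p) + (p - q) by rewrite addrA subrK.
move=> qw pw; apply/eqP; rewrite -subr_eq0 -dotvv_eq0 eq_le dotvv_ge0 andbT.
move: (x - p) (p - q) qw pw => u d; rewrite !dotvE (dotvC d u).
by lra.
Qed.

(** Continuity of the nearest point. The limit stays in the union by closedness, and any competitor
    in the limit fibre is a limit of competitors in the nearby fibres. *)
Lemma is_proj_lim (F : set_system nat) (UF : UltraFilter F)
    (L : nat -> G) L0 (x p : nat -> 'rV[R]_n) x0 p0 :
  \oo `<=` F -> L @ F --> L0 ->
  (forall c, x t 0 c @[t --> F] --> x0 0 c) ->
  (forall c, p t 0 c @[t --> F] --> p0 0 c) ->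
  (forall t, is_proj (L t) (x t) (p t)) -> is_proj L0 x0 p0.
Proof.
move=> ooF LL0 xx0 pp0 xp; split.
  by apply: (closed_lim _ union_fiber_closed LL0 pp0) => t; have [] := xp t.
move=> z [i _ Vz]; have [y Vy yz] := V_lower UF ooF LL0 Vz.
have lim_dist (w : nat -> 'rV[R]_n) (w0 : 'rV[R]_n) : (forall c, w t 0 c @[t
  --> F] --> w0 0 c) ->
    dotv (x t - w t) (x t - w t) @[t --> F] --> dotv (x0 - w0) (x0 - w0).
  move=> ww0; apply: (@cvg_dotv R n _ F _ (fun t => x t - w t) (fun t =>
    x t - w t)) => c;
    rewrite !mxE; under eq_fun => t do rewrite !mxE;
    by apply: cvgB; [exact: xx0 | exact: ww0].
apply: ler_cvg_to (lim_dist _ _ pp0) (lim_dist _ _ yz) _.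
by apply: filterE => t; have [_] := xp t; apply; exists i.
Qed.

Hypothesis V_non_antipodal : forall L : G,
  non_antipodal L (fun i => fiber (V i) L).

Lemma convex_hull_union_fiber L : convex_hull (union_fiber L) = union_fiber L.
Proof.
apply/seteqP; split => [x|x Kx C [_]]; last exact.
by apply; split => //; exact: V_convex.
Qed.

Lemma boundary_support L x p : x \in subspace_of L -> x != 0 ->
  union_fiber L p -> (forall z, union_fiber L z -> dotv x z <= dotv x p) ->
  boundary_in L (union_fiber L) p.
Proof.
move=> xL x0 Kp p_max; split; first exact: subset_closure.
move=> B pB; have pL : p \in subspace_of L.
  by case: Kp => i _ Vp; exact: (V_bundle Vp).
(* Moving from [p] in the direction [x] stays in L but exceeds the maximum of the linear form, so it
   leaves the fibre at once. *)
pose y t : 'rV[R]_n := p + t.+1%:R^-1 *: x.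
have : \forall t \near \oo, B (y t).
  have : y @ \oo --> p.
    apply: cvg_mx_entries => i c; rewrite -[X in _ --> X]addr0.
    under eq_fun => t do rewrite !mxE.
    apply: cvgD; first exact: cvg_cst.
    rewrite -(mul0r (x i c)); apply: cvgM; last exact: cvg_cst.
    exact: cvg_harmonic.
  exact.
case/filter_ex => t Byt; exists (y t); split => //; split => /=.
  by rewrite rpredD // rpredZ.
move=> /p_max; rewrite !dotvE gerDl leNgt.
by rewrite mulr_gt0 ?dotvv_gt0 ?invr_gt0 ?ltr0n.
Qed.

Lemma antipodal_support L x p q : x \in subspace_of L -> x != 0 -> p != q ->
  union_fiber L p -> union_fiber L q ->
  (forall z, union_fiber L z -> dotv x z <= dotv x p) ->
  (forall z, union_fiber L z -> dotv x q <= dotv x z) ->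
  antipodal L (convex_hull (\bigcup_j fiber (V j) L)) p q.
Proof.
move=> xL x0 pq Kp Kq p_max q_min.
rewrite -[\bigcup_j _]/(union_fiber L) convex_hull_union_fiber.
have q_max z : union_fiber L z -> dotv (- x) z <= dotv (- x) q.
  by move=> /q_min; rewrite !dotvE lerN2.
have KL z : union_fiber L z -> z \in subspace_of L.
  by case=> i _ Vz; exact: (V_bundle Vz).
have NxL : - x \in subspace_of L by rewrite rpredN.
have Nx0 : - x != 0 by rewrite oppr_eq0.
split => //; [exact: boundary_support p_max | exact: boundary_support q_max |].
exists x, [set z | z \in subspace_of L /\ dotv x z = dotv x p],
  [set z | z \in subspace_of L /\ dotv (- x) z = dotv (- x) q].
split; [split => // | split => // | by split => //; exact: KL | by split => //;
  exact: KL].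
  by exists (dotv x p); split => //; exists p; split => //; split => //;
    exact: KL.
by exists (dotv (- x) q); split => //; exists q; split => //; split => //;
  exact: KL.
Qed.

(** By convexity the segment from [v i] to [v j] lies in a set of at most n + 1 points, so two of n
    + 2 equally spaced parameters give the same point. *)
Lemma finite_union_fiber L (v : 'I_n.+1 -> 'rV[R]_n) :
  (forall i z, V i (L, z) -> z = v i) -> forall i j, v i = v j.
Proof.
move=> Vv i j.
have Kv l : union_fiber L (v l).
  by have [z Vz] := V_nonempty l L; exists l => //; rewrite -(Vv l z Vz).
have /choice[f f_eq] : forall l : 'I_n.+2, exists o : 'I_n.+1,
    (l%:R / n.+1%:R) *: v i + (1 - l%:R / n.+1%:R) *: v j = v o.
  move=> l; have [|o _ Vo] := @union_fiber_conv L (v i) (v j) (l%:R / n.+1%:R)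
    (Kv i) (Kv j).
    by rewrite divr_ge0 ?ler0n //= ler_pdivrMr ?ltr0n // mul1r ler_nat -ltnS
      ltn_ord.
  by exists o; exact: Vv Vo.
have /injectivePn[l [l' ll' f_ll']] : ~~ injectiveb f.
  by apply/negP => /injectiveP/leq_card; rewrite !card_ord ltnn.
have := f_eq l; rewrite f_ll' -f_eq => /eqP; rewrite -subr_eq0.
set a := l%:R / _; set b := l'%:R / _.
have -> : a *: v i + (1 - a) *: v j - (b *: v i + (1 - b) *: v j)
    = (a - b) *: (v i - v j).
  by apply/rowP => c; rewrite !mxE; ring.
rewrite scaler_eq0 !subr_eq0 => /orP[|/eqP//].
have n0 : n.+1%:R != 0 :> R by rewrite pnatr_eq0.
move=> /eqP/(congr1 (fun r => r * n.+1%:R)); rewrite !divfK // => /eqP.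
by rewrite eqr_nat => /eqP/val_inj ll_eq; rewrite ll_eq eqxx in ll'.
Qed.

(** If [p] and [q] differ, they are antipodal in [V i], a contradiction. If they agree, the form is
    constant on the fibre, so any two distinct points of one [V j] would be antipodal; each fibre is
    then a single point and [finite_union_fiber] applies. *)
Lemma support_common_point L x i p q : x \in subspace_of L -> x != 0 ->
  V i (L, p) -> V i (L, q) ->
  (forall z, union_fiber L z -> dotv x z <= dotv x p) ->
  (forall z, union_fiber L z -> dotv x q <= dotv x z) ->
  exists w : G * 'rV[R]_n, forall i, V i w.
Proof.
move=> xL x0 Vp Vq p_max q_min.
have Kp : union_fiber L p by exists i.
have Kq : union_fiber L q by exists i.
have [pq|pq] := eqVneq p q; last first.
  by case: (V_non_antipodal Vp Vq); exact: antipodal_support p_max q_min.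
have const z z' : union_fiber L z -> union_fiber L z' -> dotv x z <= dotv x z'.
  by move=> Kz Kz'; apply: le_trans (p_max z Kz) _; rewrite pq; exact: q_min.
have singleton j z z' : V j (L, z) -> V j (L, z') -> z = z'.
  move=> Vz Vz'; apply/eqP/negPn/negP => zz'.
  have Kz : union_fiber L z by exists j.
  have Kz' : union_fiber L z' by exists j.
  case: (V_non_antipodal Vz Vz').
  by apply: (antipodal_support xL x0) => // w Kw; exact: const.
have [v Vv] := choice (fun j => V_nonempty j L).
have v_eq := @finite_union_fiber L v (fun j z Vz => singleton j _ _ Vz (Vv j)).
by exists (L, v ord0) => j; rewrite (v_eq ord0 j); exact: Vv.
Qed.

End Bundle.
(** * Parametrization by a cube *)

Section Parametrization.
Variables (R : realType) (m k' : nat).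
Local Notation k := k'.+1.
Local Notation n := (m + k'.+1)%N.
Implicit Types s : nat -> R.

(* Polynomial spherical coordinates: a map from the cube [-1, 1]^q to
   R^(q+1) \ 0. Once s_i = 1 or s_i = -1, it is constant in s_j for j > i, and
   changing the signs of s_0, .., s_i changes the sign of the image. *)
Definition sph s q i : R :=
  (if (i < q)%N then s i else 1) * \prod_(l < i) (1 - s l ^+ 2).

Lemma sph_eq0 s q : ~ (forall i, (i <= q)%N -> sph s q i = 0).
Proof.
move=> sph0.
have prod1 i : (i <= q)%N -> \prod_(l < i) (1 - s l ^+ 2) = 1.
  elim: i => [|i IHi] iq; first by rewrite big_ord0.
  have := sph0 i (ltnW iq); rewrite /sph iq IHi ?mulr1 => [si|];
    last exact: ltnW.
  by rewrite big_ord_recr /= IHi ?si ?expr0n ?subr0 ?mulr1 // ltnW.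
have := sph0 q (leqnn q); rewrite /sph ltnn prod1 // mulr1 => /eqP.
by rewrite oner_eq0.
Qed.

(** Components beyond [i] contain the factor 1 - s_i^2 = 0, so only the parameters up to [i]
    matter. *)
Lemma sph_scale e s s' q i c : e ^+ 2 = 1 -> (i < q)%N -> (c <= q)%N ->
  (forall l, (l <= i)%N -> s' l = e * s l) -> s i ^+ 2 = 1 ->
  sph s' q c = e * sph s q c.
Proof.
move=> e2 iq cq ss' si; have [ci|ic] := leqP c i.
  rewrite /sph (leq_ltn_trans ci iq) ss' // -mulrA; congr (_ * (_ * _)).
  apply: eq_bigr => l _; rewrite ss' ?exprMn ?e2 ?mul1r //.
  exact: leq_trans (ltnW (ltn_ord l)) ci.
have zero u : u i ^+ 2 = 1 -> \prod_(l < c) (1 - u l ^+ 2) = 0 :> R.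
  by move=> ui; rewrite (bigD1 (Ordinal ic)) //= ui subrr mul0r.
by rewrite /sph !zero ?mulr0 // ss' // exprMn e2 mul1r.
Qed.

Lemma sph_ext s s' q c : (c <= q)%N ->
  (forall l, (l < q)%N -> s' l = s l) -> sph s' q c = sph s q c.
Proof.
move=> cq ss'; rewrite /sph; congr (_ * _).
  by case: ifP => // cq'; rewrite ss'.
by apply: eq_bigr => l _; rewrite ss' //; exact: leq_trans (ltn_ord l) cq.
Qed.

(** Later components involve s_0 only through its square. *)
Lemma sph_flip0 s s' q c : (c <= q)%N -> (0 < q)%N ->
  s' 0%N = - s 0%N -> (forall l, (0 < l < q)%N -> s' l = s l) ->
  sph s' q c = if c == 0%N then - sph s q c else sph s q c.
Proof.
move=> cq q0 s0 ss'; case: c cq => [|c] cq /=.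
  by rewrite /sph q0 !big_ord0 !mulr1 s0.
rewrite /sph; congr (_ * _); first by case: ifP => // cq'; rewrite ss'.
apply: eq_bigr => -[[|l] lc] _ /=; first by rewrite s0 sqrrN.
by rewrite ss' //=; exact: leq_trans lc cq.
Qed.

Lemma cvg_sph (T : Type) (F : set_system T) (FF : Filter F) (s : T -> nat -> R)
    s0 q i :
  (forall l, s t l @[t --> F] --> s0 l) ->
  sph (s t) q i @[t --> F] --> sph s0 q i.
Proof.
move=> ss0; rewrite /sph; apply: cvgM.
  by case: ifP => _; [exact: ss0 | exact: cvg_cst].
apply: (@cvg_big R _ (@GRing.mul R) 1 predT (@mul_continuous R) T F _
  (fun (l : 'I_i) t => 1 - s t l ^+ 2) (fun l : 'I_i => 1 - s0 l ^+ 2) FF) =>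
    l _.
rewrite expr2; under eq_fun => t do rewrite expr2.
by apply: cvgB; [exact: cvg_cst | apply: cvgM; exact: ss0].
Qed.

(* The rows span W + R v, where v = sph s m lies in the span of the first
   m + 1 basis vectors and W is spanned by the other ones. *)
Definition frame_of s : 'M[R]_(k, n) :=
  \matrix_(i, c) if i == 0 then (if (c <= m)%N then sph s m c else 0)
                 else (c == m + i :> nat)%N%:R.

Definition fibre_coord s (i : nat) : R := sph (fun l => s (m + l)%N) k' i.

Definition point s : 'rV[R]_n :=
  s (m + k')%N *: ((\row_i fibre_coord s i) *m frame_of s).

Lemma mul_frame_of s (y : nat -> R) (c : 'I_n) :
  ((\row_(i < k) y i) *m frame_of s) 0 c
  = if (c <= m)%N then y 0%N * sph s m c else y (c - m)%N.
Proof.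
rewrite mxE big_ord_recl /= !mxE /=; case: leqP => [cm|mc].
  rewrite big1 ?addr0 // => i _; rewrite !mxE /=.
  by rewrite (_ : (c == _ :> nat) = false) ?mulr0 //; apply/eqP; rewrite /bump;
    lia.
rewrite mulr0 add0r.
have ck : ((c - m).-1 < k')%N by have := ltn_ord c; lia.
rewrite (bigD1 (Ordinal ck)) //= big1 ?addr0 => [|i i_neq].
  rewrite !mxE /= /bump /= (_ : (c == _ :> nat) = true) ?mulr1;
    last by apply/eqP; lia.
  by congr y; lia.
rewrite !mxE /= /bump (_ : (c == _ :> nat) = false) ?mulr0 //.
by apply: contraNF i_neq => /eqP c_eq; apply/eqP/val_inj => /=; lia.
Qed.

Lemma row_of_coord (v : 'rV[R]_k) : v = \row_i v 0 (inord i).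
Proof. by apply/rowP => i; rewrite mxE inord_val. Qed.

Lemma frame_of_free s : row_free (frame_of s).
Proof.
apply: inj_row_free => v; rewrite [v]row_of_coord.
set y := fun i => v 0 (inord i); move=> yA.
have yA0 (c : 'I_n) : (if (c <= m)%N then y 0%N * sph s m c else y (c - m)%N) =
  0.
  by rewrite -mul_frame_of yA mxE.
have y_pos i : (0 < i < k)%N -> y i = 0.
  move=> /andP[i0 ik]; have mi : (m + i < n)%N by rewrite ltn_add2l.
  have := yA0 (Ordinal mi); rewrite /= (_ : (m + i <= m)%N = false);
    last by lia.
  by rewrite addKn.
have y_0 : y 0%N = 0.
  apply: contrapT => /eqP y0; apply: (@sph_eq0 s m) => c cm.
  have cn : (c < n)%N by lia.
  have := yA0 (Ordinal cn); rewrite /= cm => /eqP.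
  by rewrite mulf_eq0 (negbTE y0) => /eqP.
apply/rowP => i; rewrite !mxE -/(y i); case: i => -[|i] ik //=.
exact: y_pos.
Qed.

Definition subspace s : grassmannian R n k :=
  frame_span (mk_frame (frame_of_free s)).

Lemma point_coord s (c : 'I_n) : point s 0 c = s (m + k')%N *
  (if (c <= m)%N then fibre_coord s 0 * sph s m c else fibre_coord s (c - m)).
Proof. by rewrite mxE mul_frame_of. Qed.

Lemma point_mem s : point s \in subspace_of (subspace s).
Proof.
by apply/mem_frame_span; exists (s (m + k')%N *: \row_i fibre_coord s i);
  rewrite -scalemxAl.
Qed.

Lemma point_neq0 s : s (m + k')%N != 0 -> point s != 0.
Proof.
move=> r0; rewrite scaler_eq0 negb_or r0 mulmx_free_eq0 ?frame_of_free //.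
apply/eqP => /rowP y0; apply: (@sph_eq0 (fun l => s (m + l)%N) k') => i ik.
by have := y0 (Ordinal (ik : (i < k)%N)); rewrite !mxE.
Qed.

Lemma eq_subspace e s s' : e ^+ 2 = 1 ->
  (forall c, (c <= m)%N -> sph s' m c = e * sph s m c) ->
  subspace s' = subspace s.
Proof.
move=> e2 ss'; apply: val_inj; apply/eqP.
have sub u u' : (forall c, (c <= m)%N -> sph u' m c = e * sph u m c) ->
    (subspace_of (subspace u') <= subspace_of (subspace u))%VS.
  move=> uu'; apply/subvP => x /mem_frame_span[y ->]; apply/mem_frame_span.
  pose w i := y 0 (inord i); pose z i := (if i == 0%N then e else 1) * w i.
  exists (\row_i z i); rewrite [y in LHS]row_of_coord; apply/rowP => c.
  rewrite (mul_frame_of u' w) mul_frame_of /z /=; case: leqP => cm.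
    by rewrite uu' // mulrCA mulrA.
  by rewrite subn_eq0 leqNgt cm mul1r.
rewrite eqEsubv; apply/andP; split; apply: sub => // c cm.
by rewrite ss' // mulrA -expr2 e2 mul1r.
Qed.

Definition negate_at (P : pred nat) s (l : nat) : R :=
  if P l then - s l else s l.

Lemma negate_last s : point (negate_at (pred1 (m + k')%N) s) = - point s /\
  subspace (negate_at (pred1 (m + k')%N) s) = subspace s.
Proof.
set s' := negate_at _ s.
have ss' l : (l < m + k')%N -> s' l = s l.
  by move=> lm; rewrite /s' /negate_at /= ltn_eqF.
have fib i : (i <= k')%N -> fibre_coord s' i = fibre_coord s i.
  by move=> ik; apply: sph_ext => // l lk; apply: ss'; rewrite ltn_add2l.
have base c : (c <= m)%N -> sph s' m c = sph s m c.
  by move=> cm; apply: sph_ext => // l lm; apply: ss'; exact: ltn_addr.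
split; last by apply: (@eq_subspace 1) => [|c cm];
  rewrite ?expr1n // mul1r base.
apply/rowP => c; rewrite [RHS]mxE !point_coord /s' {1}/negate_at /= eqxx mulNr
  -/s'.
congr (- (_ * _)); case: leqP => cm; first by rewrite base ?fib.
by rewrite fib //; have := ltn_ord c; lia.
Qed.

Lemma update_degenerate s s' i j : (i < j)%N ->
  (j < m)%N || (m <= i)%N && (j < m + k')%N -> s i ^+ 2 = 1 ->
  (forall l, (l < n)%N -> l != j -> s' l = s l) ->
  point s' = point s /\ subspace s' = subspace s.
Proof.
move=> ij jm si ss'.
have fib l : (l <= k')%N -> fibre_coord s' l = fibre_coord s l.
  move=> lk; case/orP: jm => [jm|/andP[mi jk]].
    by apply: sph_ext => // l' lk'; apply: ss'; lia.
  rewrite -[RHS]mul1r; apply: (@sph_scale _ _ _ _ (i - m)%N);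
    rewrite ?expr1n ?subnKC //; first lia.
  by move=> l' lk'; rewrite mul1r; apply: ss'; lia.
have base c : (c <= m)%N -> sph s' m c = sph s m c.
  move=> cm; case/orP: jm => [jm|/andP[mi jk]].
    rewrite -[RHS]mul1r; apply: (@sph_scale _ _ _ _ i); rewrite ?expr1n //;
      first lia.
    by move=> l' lk'; rewrite mul1r; apply: ss'; lia.
  by apply: sph_ext => // l' lm; apply: ss'; lia.
split; last by apply: (@eq_subspace 1) => [|c cm];
  rewrite ?expr1n // mul1r base.
apply/rowP => c; rewrite !point_coord ss'; [|lia|lia].
congr (_ * _); case: leqP => cm; first by rewrite base ?fib.
by rewrite fib //; have := ltn_ord c; lia.
Qed.

(** Reversing v together with its coefficient fixes the point. The sign of parameter [m] is what
    reverses that coefficient. *)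
Lemma update_base s s' i : (i < m)%N -> s i ^+ 2 = 1 ->
  (forall l, (l < n)%N -> s' l = negate_at (fun l =>
    (l <= i) || (l == m))%N s l) ->
  point s' = point s /\ subspace s' = subspace s.
Proof.
move=> im si ss'.
have base c : (c <= m)%N -> sph s' m c = -1 * sph s m c.
  move=> cm; apply: (@sph_scale _ _ _ _ i); rewrite ?sqrrN ?expr1n // => l li.
  by rewrite ss' /negate_at ?li ?mulN1r //; lia.
have sm : s' m = - s m by rewrite ss' /negate_at ?eqxx ?orbT //; lia.
have above l : (m < l < n)%N -> s' l = s l.
  move=> /andP[ml ln]; rewrite ss' // /negate_at.
  by rewrite (_ : (l <= i) || (l == m) = false)%N //; lia.
split; last first.
  by apply: (@eq_subspace (-1)) => [|c cm]; rewrite ?sqrrN ?expr1n ?base.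
(* If [k' = 0], the fibre is the line R v and parameter [m] is the radius. Otherwise it is the first
   spherical parameter of the fibre, whose sign affects the coefficient of v only. *)
apply/rowP => c; rewrite !point_coord; have [k0|k0] := posnP k'.
  have fib l : (l <= k')%N -> fibre_coord s' l = fibre_coord s l.
    by move=> lk; apply: sph_ext => // l'; rewrite {1}k0.
  have -> : (m + k')%N = m by rewrite k0 addn0.
  rewrite sm mulNr -mulrN; congr (_ * _).
  case: leqP => cm; first by rewrite base // fib // mulN1r mulrN opprK.
  by have := ltn_ord c; lia.
have fib l : (l <= k')%N ->
    fibre_coord s' l = if l == 0%N then - fibre_coord s l else fibre_coord s l.
  move=> lk; apply: sph_flip0 => //; first by rewrite addn0.
  by move=> l' lk'; apply: above; lia.
rewrite above; last by lia.
congr (_ * _); case: leqP => cm; first by rewrite base // fib //= mulN1r mulrNN.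
rewrite fib; last by have := ltn_ord c; lia.
by rewrite subn_eq0 leqNgt cm.
Qed.

Lemma update_fibre s s' i : (m <= i < m + k')%N -> s i ^+ 2 = 1 ->
  (forall l, (l < n)%N -> s' l = negate_at (fun l => m <= l <= i)%N s l) ->
  point s' = - point s /\ subspace s' = subspace s.
Proof.
move=> /andP[mi ik] si ss'.
have fib l : (l <= k')%N -> fibre_coord s' l = - fibre_coord s l.
  move=> lk; rewrite -mulN1r; apply: (@sph_scale _ _ _ _ (i - m)%N);
    rewrite ?sqrrN ?expr1n ?subnKC //; first lia.
  move=> l' li; rewrite ss'; last by lia.
  by rewrite /negate_at (_ : (m <= _ <= i)%N) ?mulN1r //; lia.
have base c : (c <= m)%N -> sph s' m c = sph s m c.
  move=> cm; apply: sph_ext => // l lm; rewrite ss'; last by lia.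
  by rewrite /negate_at leqNgt lm.
split; last by apply: (@eq_subspace 1) => [|c cm];
  rewrite ?expr1n // mul1r base.
apply/rowP => c; rewrite [RHS]mxE !point_coord ss'; last by lia.
rewrite {1}/negate_at (_ : (m <= _ <= i)%N = false); last by lia.
rewrite -mulrN; congr (_ * _); case: leqP => cm;
  first by rewrite base ?fib ?mulNr.
by rewrite fib //; have := ltn_ord c; lia.
Qed.

Lemma cvg_subspace (T : Type) (F : set_system T) (FF : Filter F)
    (s : T -> nat -> R) s0 :
  (forall l, s t l @[t --> F] --> s0 l) ->
  subspace (s t) @[t --> F] --> subspace s0.
Proof.
move=> ss0; apply: cvg_frame_span => i c /=.
rewrite mxE; under eq_fun => t do rewrite mxE.
by case: ifP => _; [case: ifP => _; [exact: cvg_sph | exact: cvg_cst] | exact: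
  cvg_cst].
Qed.

Lemma cvg_point (T : Type) (F : set_system T) (FF : Filter F)
    (s : T -> nat -> R) s0 :
  (forall l, s t l @[t --> F] --> s0 l) ->
  forall c, point (s t) 0 c @[t --> F] --> point s0 0 c.
Proof.
move=> ss0 c; rewrite point_coord; under eq_fun => t do rewrite point_coord.
have cvg_fibre i : fibre_coord (s t) i @[t --> F] --> fibre_coord s0 i.
  by apply: (@cvg_sph _ _ _ (fun t l => s t (m + l)%N)) => l; exact: ss0.
apply: cvgM; first exact: ss0.
by case: ifP => _; [apply: cvgM; [exact: cvg_fibre | exact: cvg_sph] | exact:
  cvg_fibre].
Qed.

End Parametrization.
(** * The common point *)

Section Limits.
Variables (R : realType) (F : set_system nat).
Hypothesis UF : UltraFilter F.

Lemma ultra_cvg_cube (s : nat -> nat -> R) : (forall t l, `|s t l| <= 1) ->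
  exists2 s0 : nat -> R, forall l, `|s0 l| <= 1 &
    forall l, s t l @[t --> F] --> s0 l.
Proof.
move=> s1; have /choice[s0 s0P] : forall l, exists r : R,
    s t l @[t --> F] --> r /\ `|r| <= 1.
  move=> l; have [r sr r1] := @ultra_cvg_bounded R nat F UF (fun t =>
    s t l) 1 (s1 ^~ l).
  by exists r.
by exists s0 => l; have [] := s0P l.
Qed.

Lemma ultra_cvg_row n (p : nat -> 'rV[R]_n) M : (forall t c, `|p t 0 c| <= M) ->
  exists p0 : 'rV[R]_n, forall c, p t 0 c @[t --> F] --> p0 0 c.
Proof.
move=> pM; have /choice[f fP] : forall c, exists r : R, p t 0 c @[t --> F] -->
  r.
  move=> c; have [r pr _] := @ultra_cvg_bounded R nat F UF (fun t =>
    p t 0 c) M (pM ^~ c).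
  by exists r.
by exists (\row_c f c) => c; rewrite mxE.
Qed.

Lemma ultra_cvg_cst (u : nat -> R) (a b : R) :
  (forall t, u t = a) -> u @ F --> b -> b = a.
Proof.
move=> ua; rewrite (funext ua : u = cst a) => ub.
by apply: (cvg_unique _ ub); [exact: Rhausdorff | exact: cvg_cst].
Qed.

Lemma ultra_cvg_close (u v : nat -> R) (a : R) : \oo `<=` F ->
  (forall t, `|v t - u t| <= t.+1%:R^-1) -> u @ F --> a -> v @ F --> a.
Proof.
move=> ooF uv ua; rewrite -[a]addr0.
rewrite (_ : v = fun t => u t + (v t - u t)); last first.
  by apply/funext => t; rewrite addrC subrK.
apply: cvgD => //; apply/norm_cvg0P.
apply: (@squeeze_cvgr _ _ _ _ (cst 0) (fun t => t.+1%:R^-1)).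
- by apply: filterE => t; rewrite normr_ge0 uv.
- exact: cvg_cst.
- by apply: cvg_trans (@cvg_harmonic R); apply: cvg_app.
Qed.

End Limits.

Lemma ultra_nat : exists2 F : set_system nat, UltraFilter F & \oo `<=` F.
Proof. by have [F [UF ooF]] := @ultraFilterLemma nat \oo _; exists F. Qed.

Section Assembly.
Variables (R : realType) (m k' : nat).
Local Notation k := k'.+1.
Local Notation n := (m + k'.+1)%N.
Local Notation G := (grassmannian R n k).
Local Notation plane := (@subspace R m k').
Local Notation spoint := (@point R m k').
Variable V : 'I_n.+1 -> set (G * 'rV[R]_n).
Hypothesis V_bundle : forall i, V i `<=` @canonical_bundle R n k.
Hypothesis V_compact : forall i, compact (V i).
Hypothesis V_nonempty : forall i L, fiber (V i) L !=set0.
Hypothesis V_continuous : forall i (L0 : G),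
  hausdorff_dist (fiber (V i) L) (fiber (V i) L0) @[L --> L0] --> (0 : R).
Hypothesis V_non_antipodal : forall L : G,
  non_antipodal L (fun i => fiber (V i) L).
Hypothesis V_convex : forall L : G,
  @convex_set R 'rV[R]_n (fiber (\bigcup_i V i) L).
Hypothesis no_common_point : ~ exists w : G * 'rV[R]_n, forall i, V i w.
Implicit Types s : nat -> R.

Definition antipode_of s := negate_at (pred1 (m + k')%N) s.

Definition proj (L : G) x : 'rV[R]_n := xget 0 (is_proj V L x).

Lemma projP L x : is_proj V L x (proj L x).
Proof. exact: (xgetPex 0 (is_proj_exists V_compact V_nonempty L x)). Qed.

(* For large [rho], nearest points to [rho x] and [- rho x] are almost antipodal
   in the fibre, while they depend continuously on [x]. *)
Definition image_point (rho : R) s := proj (plane s) (rho *: spoint s).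

Definition hits rho i s := V i (plane s, image_point rho s).

Lemma union_fiber_bounded : exists2 M : R, 0 <= M &
  forall L x c, union_fiber V L x -> `|x 0 c| <= M.
Proof.
have [M M0 VM] := V_bounded V_compact; exists M => // L x c [i _].
exact: VM.
Qed.

(** Comparing the squared distances from rho x to [p] and to a competitor [y] bounds rho times the
    difference of x . y and x . p by a constant, so this difference is at most of order 1/rho. *)
Lemma proj_support_lim (F : set_system nat) (UF : UltraFilter F) (L : nat -> G)
    (L0 : G) (rho : nat -> R) (x p : nat -> 'rV[R]_n) (x0 p0 : 'rV[R]_n) :
  \oo `<=` F -> L @ F --> L0 -> (forall t, t.+1%:R <= rho t) ->
  (forall c, x t 0 c @[t --> F] --> x0 0 c) ->
  (forall c, p t 0 c @[t --> F] --> p0 0 c) ->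
  (forall t, is_proj V (L t) (rho t *: x t) (p t)) ->
  forall z, union_fiber V L0 z -> dotv x0 z <= dotv x0 p0.
Proof.
move=> ooF LL0 rho_ge xx0 pp0 xp z [i _ Vz].
have [y Vy yz] := V_lower V_compact V_nonempty V_continuous UF ooF LL0 Vz.
have [M M0 KM] := union_fiber_bounded; pose C := n%:R * M ^+ 2.
have C0 : 0 <= C by rewrite mulr_ge0 ?ler0n ?sqr_ge0.
have yC t : dotv (y t) (y t) <= C.
  rewrite /C mulr_natl -[X in M ^+ 2 *+ X](card_ord n) -sumr_const.
  apply: ler_sum => c _; rewrite -expr2 -real_normK ?num_real //.
  by rewrite ler_sqr ?nnegrE ?normr_ge0 //; apply: (KM (L t)); exists i.
have bound t : dotv (x t) (y t) <= dotv (x t) (p t) + C * t.+1%:R^-1.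
  have [_ /(_ (y t))] := xp t; rewrite /union_fiber =>
    /(_ (ex_intro2 _ _ i I (Vy t))).
  rewrite !dotvE !(dotvC (y t) (x t)) !(dotvC (p t) (x t)) => p_le.
  have t0 : 0 < t.+1%:R :> R by rewrite ltr0n.
  have rho0 : 0 < rho t by exact: lt_le_trans t0 (rho_ge t).
  have le1 : rho t * (dotv (x t) (y t) - dotv (x t) (p t)) <= C.
    by have := dotvv_ge0 (p t); have := yC t; lra.
  rewrite -lerBlDl; apply: le_trans (_ : C / rho t <= _).
    by rewrite ler_pdivlMr // mulrC.
  by rewrite ler_wpM2l // lef_pV2 ?posrE.
have lim_y : dotv (x t) (y t) @[t --> F] --> dotv x0 z by exact: cvg_dotv.
have lim_p : dotv (x t) (p t) + C * t.+1%:R^-1 @[t --> F] --> dotv x0 p0.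
  rewrite -[X in _ --> X]addr0; apply: cvgD; first exact: cvg_dotv.
  rewrite -(mulr0 C); apply: cvgM; first exact: cvg_cst.
  by apply: cvg_trans (@cvg_harmonic R); apply: cvg_app.
by apply: ler_cvg_to lim_y lim_p _; apply: filterE.
Qed.

Lemma subspace_antipode s : plane (antipode_of s) = plane s.
Proof. by have [_] := @negate_last R m k' s. Qed.

Lemma point_antipode s : spoint (antipode_of s) = - spoint s.
Proof. by have [] := @negate_last R m k' s. Qed.

(** Counterexamples with rho tending to infinity would have limits [p0] and [q0] in one [V i] at
    which the same linear form is maximal and minimal, and [support_common_point] would give a
    common point. *)
Lemma separation_radius i : exists J : nat, forall rho : nat, (J <= rho)%N ->
  forall s, (forall l, `|s l| <= 1) -> s (m + k')%N = 1 ->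
  hits rho%:R i s -> hits rho%:R i (antipode_of s) -> False.
Proof.
apply: contrapT => no_J.
have /choice[w wP] : forall t, exists w : nat * (nat -> R),
    [/\ (t.+1 <= w.1)%N, forall l, `|w.2 l| <= 1, w.2 (m + k')%N = 1,
      hits w.1%:R i w.2 & hits w.1%:R i (antipode_of w.2)].
  move=> t; apply: contrapT => no_w; apply: no_J;
    exists t.+1 => rho t_rho s s1 sr h h'.
  by apply: no_w; exists (rho, s).
have [F UF ooF] := ultra_nat.
pose s t := (w t).2; pose rho t : R := (w t).1%:R.
have s1 t l : `|s t l| <= 1 by have [_ + _ _ _] := wP t; apply.
have [s0 s01 ss0] := ultra_cvg_cube UF s1.
have s0r : s0 (m + k')%N = 1.
  by apply: (ultra_cvg_cst UF _ (ss0 _)) => t; have [] := wP t.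
have rho_ge t : t.+1%:R <= rho t by rewrite ler_nat; have [] := wP t.
have [M M0 KM] := union_fiber_bounded.
have Vp t : hits (rho t) i (s t) by have [] := wP t.
have LL0 : plane (s t) @[t --> F] --> plane s0 by exact: cvg_subspace.
have xx0 c : spoint (s t) 0 c @[t --> F] --> spoint s0 0 c by exact: cvg_point.
pose p t := image_point (rho t) (s t).
pose q t := image_point (rho t) (antipode_of (s t)).
have Vq t : V i (plane (s t), q t).
  by rewrite -subspace_antipode; have [] := wP t.
have pM t c : `|p t 0 c| <= M by apply: (KM (plane (s t))); exists i => //;
  exact: Vp.
have qM t c : `|q t 0 c| <= M by apply: (KM (plane (s t))); exists i => //;
  exact: Vq.
have [p0 pp0] := ultra_cvg_row UF pM; have [q0 qq0] := ultra_cvg_row UF qM.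
have Vp0 : V i (plane s0, p0).
  exact: (closed_lim _ (V_closed V_compact (i := i)) LL0 pp0).
have Vq0 : V i (plane s0, q0).
  exact: (closed_lim _ (V_closed V_compact (i := i)) LL0 qq0).
have proj_p t : is_proj V (plane (s t)) (rho t *: spoint (s t)) (p t) :=
  projP _ _.
have proj_q t : is_proj V (plane (s t)) (rho t *: - spoint (s t)) (q t).
  by rewrite -point_antipode -(subspace_antipode (s t)); exact: projP.
have p_max := proj_support_lim UF ooF LL0 rho_ge xx0 pp0 proj_p.
have q_min z : union_fiber V (plane s0) z ->
    dotv (spoint s0) q0 <= dotv (spoint s0) z.
  have Nxx0 c : (- spoint (s t)) 0 c @[t --> F] --> (- spoint s0) 0 c.
    by rewrite mxE; under eq_fun => t do rewrite mxE; apply: cvgN; exact: xx0.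
  move=> /(proj_support_lim UF ooF LL0 rho_ge Nxx0 qq0 proj_q).
  by rewrite !dotvE lerN2.
apply: no_common_point.
apply: (support_common_point V_bundle V_nonempty V_convex V_non_antipodal
  (@point_mem R m k' s0) _ Vp0 Vq0 p_max q_min).
by rewrite point_neq0 // s0r oner_neq0.
Qed.

(** For fixed rho the sets of the cover are closed, as the nearest point varies continuously. *)
Lemma hits_lim (F : set_system nat) (UF : UltraFilter F) rho i (s : nat -> nat
  -> R) s0 :
  \oo `<=` F -> (forall l, s t l @[t --> F] --> s0 l) ->
  (forall t, hits rho i (s t)) -> hits rho i s0.
Proof.
move=> ooF ss0 Vs; have [M M0 KM] := union_fiber_bounded.
pose p t := image_point rho (s t).
have pM t c : `|p t 0 c| <= M.
  by apply: (KM (plane (s t))); exists i => //; exact: Vs.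
have [p0 pp0] := ultra_cvg_row UF pM.
have LL0 : plane (s t) @[t --> F] --> plane s0 by exact: cvg_subspace.
have xx0 c : (rho *: spoint (s t)) 0 c @[t --> F] --> (rho *: spoint s0) 0 c.
  rewrite mxE; under eq_fun => t do rewrite mxE.
  by apply: cvgM; [exact: cvg_cst | exact: cvg_point].
have p0_proj : is_proj V (plane s0) (rho *: spoint s0) p0.
  apply: (is_proj_lim V_compact V_nonempty V_continuous UF ooF LL0 xx0 pp0).
  by move=> t; exact: projP.
rewrite /hits /image_point (is_proj_uniq V_convex (projP _ _) p0_proj).
exact: (closed_lim _ (V_closed V_compact (i := i)) LL0 pp0).
Qed.

(** Vertices of one simplex are close but distinct, so exact antipodality is not enough; as the mesh
    tends to 0 both parameters tend to one boundary point, which [sep] excludes. *)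
Lemma separation_mesh (rho : R) i :
  (forall s, (forall l, `|s l| <= 1) -> s (m + k')%N = 1 ->
     hits rho i s -> hits rho i (antipode_of s) -> False) ->
  exists J : nat, forall N : nat, (J <= N)%N -> forall s s',
    (forall l, `|s l| <= 1) -> (forall l, `|s' l| <= 1) ->
    s (m + k')%N = 1 -> (forall l, `|s' l - s l| <= N%:R^-1) ->
    hits rho i s -> hits rho i (antipode_of s') -> False.
Proof.
move=> sep; apply: contrapT => no_J.
have /choice[w wP] : forall t, exists w : nat * (nat -> R) * (nat -> R),
    [/\ (t.+1 <= w.1.1)%N, forall l, `|w.1.2 l| <= 1, w.1.2 (m + k')%N = 1,
      forall l, `|w.2 l - w.1.2 l| <= w.1.1%:R^-1 &
      hits rho i w.1.2 /\ hits rho i (antipode_of w.2)].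
  move=> t; apply: contrapT => no_w; apply: no_J; exists t.+1.
  by move=> N tN s s' s1 s'1 sr ss' h h'; apply: no_w; exists (N, s, s').
have [F UF ooF] := ultra_nat.
pose s t := (w t).1.2; pose s' t := (w t).2.
have s1 t l : `|s t l| <= 1 by have [_ + _ _ _] := wP t; apply.
have [s0 s01 ss0] := ultra_cvg_cube UF s1.
have s0r : s0 (m + k')%N = 1.
  by apply: (ultra_cvg_cst UF _ (ss0 _)) => t; have [] := wP t.
have s's0 l : s' t l @[t --> F] --> s0 l.
  apply: (ultra_cvg_close UF ooF _ (ss0 l)) => t.
  have [tN _ _ + _] := wP t; move=> /(_ l)/le_trans; apply.
  by rewrite lef_pV2 ?posrE ?ltr0n ?ler_nat //; exact: leq_trans tN.
apply: (sep s0 s01 s0r).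
  by apply: (hits_lim UF ooF ss0) => t; have [_ _ _ _ []] := wP t.
apply: (@hits_lim F UF rho i (fun t => antipode_of (s' t))) => // [l|t].
  by rewrite /antipode_of /negate_at; case: ifP => _; [apply: cvgN|];
    exact: s's0.
by have [_ _ _ _ []] := wP t.
Qed.

(** The barycentre of the cell, with entries 0, .., 2N rescaled to [-1, 1]. Beyond the last
    coordinate the default entry gives the constant -1 for every cell, so bounds and limits hold for
    all indices. *)
Definition cell_param N (F : seq nat) (l : nat) : R :=
  (nth 0%N F l)%:R / N%:R - 1.

Lemma cell_param_le1 N F l : (0 < N)%N -> valid_cell N n F ->
  `|cell_param N F l| <= 1.
Proof.
move=> N0 /andP[_ F_le]; have FN : (nth 0 F l <= N.*2)%N.
  by have [lF|Fl] := ltnP l (size F); [exact: (all_nthP 0%N F_le) | rewrite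
    nth_default].
have N0' : 0 < N%:R :> R by rewrite ltr0n.
have p_ge0 : 0 <= (nth 0%N F l)%:R / N%:R :> R by rewrite divr_ge0 ?ler0n.
have p_le2 : (nth 0%N F l)%:R / N%:R <= 2 :> R.
  by rewrite ler_pdivrMr // -natrM ler_nat mul2n.
by rewrite /cell_param ler_norml; lra.
Qed.

Lemma cell_param_extremal N F l : (0 < N)%N -> extremal N (nth 0%N F l) ->
  cell_param N F l ^+ 2 = 1.
Proof.
move=> N0; rewrite /cell_param => /orP[] /eqP ->.
  by rewrite mul0r sub0r sqrrN expr1n.
have N0' : N%:R != 0 :> R by rewrite pnatr_eq0 -lt0n.
by rewrite -muln2 natrM mulrAC divff // mul1r -[2]/(1 + 1) addrK expr1n.
Qed.

Lemma cell_param_flip N (c : pred nat) F l : (0 < N)%N -> valid_cell N n F ->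
  (l < n)%N -> cell_param N (flip N c F) l = negate_at c (cell_param N F) l.
Proof.
move=> N0 F_valid ln; rewrite /cell_param /negate_at (nth_flip _ F_valid) //.
case: (c l) => //; have N0' : N%:R != 0 :> R by rewrite pnatr_eq0 -lt0n.
have /andP[/eqP F_size F_le] := F_valid.
have FN : (nth 0 F l <= N.*2)%N by apply: (all_nthP 0%N F_le); rewrite F_size.
rewrite natrB // -muln2 natrM mulrBl mulrAC divff // mul1r.
by rewrite opprB; ring.
Qed.

Lemma cell_param_antipode N F : (0 < N)%N -> valid_cell N n F ->
  cell_param N (flip N (pred1 (m + k')%N) F) = antipode_of (cell_param N F).
Proof.
move=> N0 F_valid; apply/funext => l; have [ln|nl] := ltnP l n.
  exact: cell_param_flip.
have /andP[/eqP F_size _] := F_valid.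
rewrite /antipode_of /negate_at /= (_ : l == _ = false); last by lia.
by rewrite /cell_param !nth_default ?size_coordwise ?F_size.
Qed.

Lemma face_nth G0 G1 l : face G0 G1 ->
  (nth 0 G0 l <= (nth 0 G1 l).+1)%N && (nth 0 G1 l <= (nth 0 G0 l).+1)%N.
Proof.
elim: G0 G1 l => [|p G0 IH] [|q G1] [|l] //= /andP[pq GG]; last exact: IH.
by move: pq; rewrite /coface_step; lia.
Qed.

Lemma cell_param_close N G0 G1 l : (0 < N)%N -> face G0 G1 || face G1 G0 ->
  `|cell_param N G1 l - cell_param N G0 l| <= N%:R^-1.
Proof.
move=> N0 GG; have {GG} : (nth 0 G0 l <= (nth 0 G1 l).+1)%N && (nth 0 G1 l <=
  (nth 0 G0 l).+1)%N.
  by case/orP: GG => /(face_nth l) //; rewrite andbC.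
rewrite -!(ler_nat R) -!natr1 => /andP[le01 le10].
rewrite /cell_param opprB addrA subrK -mulrBl normrM (gtr0_norm (_ : 0 <
  N%:R^-1)).
  by rewrite -[leRHS]mul1r ler_wpM2r ?invr_ge0 ?ler0n // ler_norml; lra.
by rewrite invr_gt0 ltr0n.
Qed.

Lemma exists_rainbow (rho : R) J N :
  (forall i N, (J <= N)%N -> forall s s',
    (forall l, `|s l| <= 1) -> (forall l, `|s' l| <= 1) ->
    s (m + k')%N = 1 -> (forall l, `|s' l - s l| <= N%:R^-1) ->
    hits rho i s -> hits rho i (antipode_of s') -> False) ->
  (J <= N)%N -> (0 < N)%N ->
  exists s : 'I_n.+1 -> nat -> R,
    [/\ forall i l, `|s i l| <= 1, forall i, hits rho i (s i) &
      forall i j l, `|s i l - s j l| <= N%:R^-1].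
Proof.
move=> sep JN N0.
have nE : n.-1 = (m + k')%N by rewrite addnS.
(* The label is chosen for the pair of plane and point rather than for the cell, so that collapsed
   or identified cells receive equal labels. *)
have /choice[lab0 lab0P] : forall Lx : G * 'rV[R]_n, exists i,
    V i (Lx.1, proj Lx.1 (rho *: Lx.2)).
  by move=> [L x]; have [[i _ Vi] _] := projP L (rho *: x); exists i.
pose lab F := nat_of_ord (lab0 (plane (cell_param N F), spoint (cell_param N
  F))).
have lab_eq F F' : spoint (cell_param N F') = spoint (cell_param N F) /\
    plane (cell_param N F') = plane (cell_param N F) -> lab F' = lab F.
  by move=> [pE sE]; rewrite /lab pE sE.
have lab_hits F (i : 'I_n.+1) : lab F = i :> nat -> hits rho i (cell_param N F).
  by move=> /val_inj <-; exact: (lab0P (_, _)).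
have [s [s_sorted s_valid s_size s_perm]] : exists s : seq (seq nat), [/\
  sorted face s,
    all (valid_cell N n) s, size s = n.+1 & perm_eq (map lab s) (iota 0 n.+1)].
  apply: (@full_flag N n m lab).
  - by rewrite -[X in (X < _)%N]addn0 ltn_add2l.
  - by move=> F _; rewrite -ltnS /lab; exact: ltn_ord.
  - move=> i j q F F_valid ij; rewrite nE => jm F_ext qN; apply: lab_eq.
    apply: (update_degenerate ij jm); first exact: cell_param_extremal.
    move=> l ln lj; rewrite /cell_param /set_coord nth_coordwise.
      by rewrite (negbTE lj).
    by case/andP: F_valid => /eqP->.
  - move=> i F F_valid im F_ext; apply: lab_eq; apply: (update_base im).
      exact: cell_param_extremal.
    by move=> l ln; exact: cell_param_flip.
  - move=> i F F_valid; rewrite nE => imk F_ext; apply: lab_eq.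
    rewrite cell_param_antipode // point_antipode subspace_antipode.
    apply: (update_fibre imk); first exact: cell_param_extremal.
    by move=> l ln; exact: cell_param_flip.
  move=> F F' F_valid F'_valid; rewrite nE => F_last F'_last FF'.
  apply/eqP => lab_FF'; pose i := lab0 (plane (cell_param N F), spoint
    (cell_param N F)).
  apply: (sep i N JN (cell_param N F) (cell_param N F')).
  - by move=> l; exact: cell_param_le1.
  - by move=> l; exact: cell_param_le1.
  - rewrite /cell_param F_last -muln2 natrM mulrAC divff ?mul1r ?pnatr_eq0
    -?lt0n //.
    by rewrite -[2]/(1 + 1) addrK.
  - by move=> l; exact: cell_param_close.
  - exact: lab_hits.
  - by rewrite -cell_param_antipode //; apply: lab_hits; rewrite -lab_FF'.
have /choice[f fP] : forall i : 'I_n.+1, exists F, F \in s /\ lab F = i :> nat.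
  move=> i; have : (i : nat) \in map lab s by rewrite (perm_mem s_perm)
    mem_iota ltn_ord.
  by move=> /mapP[F Fs iF]; exists F.
exists (fun i => cell_param N (f i)); split => [i l|i|i j l].
- by apply: cell_param_le1 => //; apply: (allP s_valid); have [] := fP i.
- by apply: lab_hits; have [] := fP i.
- apply: cell_param_close => //; apply: face_or s_sorted _ _;
  first by have [] := fP j.
  by have [] := fP i.
Qed.

(** With rho fixed, fully labelled simplices of mesh tending to 0 have all their vertices converging
    to one parameter [s0], and [hits_lim] puts its image point in every [V i]. *)
Lemma common_point_absurd : False.
Proof.
have [J JP] := choice separation_radius.
pose rho : R := (\max_i J i)%:R.
have sep i s : (forall l, `|s l| <= 1) -> s (m + k')%N = 1 ->
    hits rho i s -> hits rho i (antipode_of s) -> False.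
  by apply: (JP i); exact: leq_bigmax.
have [J' J'P] := choice (fun i => separation_mesh (sep i)).
pose J0 := (\max_i J' i)%N.
have sep_mesh i N : (J0 <= N)%N -> forall s s',
    (forall l, `|s l| <= 1) -> (forall l, `|s' l| <= 1) ->
    s (m + k')%N = 1 -> (forall l, `|s' l - s l| <= N%:R^-1) ->
    hits rho i s -> hits rho i (antipode_of s') -> False.
  by move=> JN; apply: (J'P i); apply: leq_trans JN; exact: leq_bigmax.
have /choice[s sP] : forall t, exists s : 'I_n.+1 -> nat -> R,
    [/\ forall i l, `|s i l| <= 1, forall i, hits rho i (s i) &
      forall i j l, `|s i l - s j l| <= (J0 + t.+1)%:R^-1].
  by move=> t; apply: (exists_rainbow sep_mesh); rewrite ?leq_addr // addnS.
have [F UF ooF] := ultra_nat.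
have [|s0 _ ss0] := @ultra_cvg_cube R F UF (fun t => s t ord0).
  by move=> t l; have [+ _ _] := sP t; apply.
apply: no_common_point; exists (plane s0, image_point rho s0) => i.
apply: (hits_lim UF ooF (s := fun t => s t i)) => [l|t];
  last by have [_ + _] := sP t; apply.
apply: (ultra_cvg_close UF ooF _ (ss0 l)) => t.
have [_ _ /(_ i ord0 l)/le_trans] := sP t; apply.
by rewrite lef_pV2 ?posrE ?ltr0n ?ler_nat ?leq_addl // addnS.
Qed.

End Assembly.

Theorem theorem2p9 (R : realType) (n k : nat)
    (k_ge1 : (1 <= k)%N) (k_le_n : (k <= n)%N)
    (V : 'I_n.+1 -> set (grassmannian R n k * 'rV[R]_n))
    (V_bundle : forall i, V i `<=` @canonical_bundle R n k)
    (V_compact : forall i, compact (V i))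
    (V_nonempty : forall i L, fiber (V i) L !=set0)
    (V_continuous : forall i (L0 : grassmannian R n k),
      hausdorff_dist (fiber (V i) L) (fiber (V i) L0) @[L --> L0] --> (0 : R))
    (V_non_antipodal : forall L : grassmannian R n k,
      non_antipodal L (fun i => fiber (V i) L))
    (V_convex : forall L : grassmannian R n k,
      @convex_set R 'rV[R]_n (fiber (\bigcup_i V i) L)) :
  exists p, forall i, V i p.
Proof.
case: k k_ge1 k_le_n V V_bundle V_compact V_nonempty V_continuous
  V_non_antipodal
  V_convex => // k' _ k'n.
have [m n_eq] : exists m, n = (m + k'.+1)%N by exists (n - k'.+1)%N;
  rewrite subnK.
subst n => V V_bundle V_compact V_nonempty V_continuous V_non_antipodal
  V_convex.
apply: contrapT => no_common.
exact: common_point_absurd V_bundle V_compact V_nonempty V_continuous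
  V_non_antipodal V_convex no_common.
Qed.
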